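(* Let $\sigma_1\le\sigma_2\le\cdots\le\sigma_k$. Let $e_1=p^{-1}(1-\exp\{-p/(n_1+n_2-1)\})$, $e_2=p^{-1}(1-\exp\{-p/(n-k+1)\})$ with $n=\sum_{j=1}^kn_j$, and $d_{0i}=p^{-1}(1-e^{-p/n_i})$. Then, under the linex loss $L(\sigma_i,\delta)=\exp\{p(\delta/\sigma_i-1)\}-p(\delta/\sigma_i-1)-1$: (i) the unrestricted best affine equivariant estimator $d_{01}T_1$ of $\sigma_1$ is inadmissible and is dominated by the estimator which, with $V_2=T_2/T_1$, equals $e_1T_1$ if $d_{01}<e_1$; $d_{01}T_1$ if $e_1\le d_{01}\le e_1(1+V_2)$; and $e_1(1+V_2)T_1$ if $d_{01}>e_1(1+V_2)$; (ii) for each $i=2,\dots,k$, the unrestricted best affine equivariant estimator $d_{0i}T_i$ of $\sigma_i$ is inadmissible and is dominated by the estimator which, with $V_j=T_j/T_i$ for $j\ne i$, equals $e_2\big(1+\sum_{j=1}^{i-1}V_j\big)T_i$ if $d_{0i}<e_2\big(1+\sum_{j=1}^{i-1}V_j\big)$, and equals $d_{0i}T_i$ otherwise.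
   Context: Let $k\ge2$, let $n_1,\dots,n_k\ge2$ be integers and let $p\ne0$ be a fixed real number. For $i=1,\dots,k$, $(X_{i1},\dots,X_{in_i})$ is a random sample from the exponential distribution with unknown location $\mu_i\in\mathbb R$ and unknown scale $\sigma_i>0$ (density $\sigma_i^{-1}e^{-(x-\mu_i)/\sigma_i}$, $x>\mu_i$), and the $k$ samples are independent. Put $X_{i(1)}=\min_{1\le j\le n_i}X_{ij}$ and $T_i=\sum_{j=1}^{n_i}(X_{ij}-X_{i(1)})$. Then all of $X_{1(1)},\dots,X_{k(1)},T_1,\dots,T_k$ are independent and $T_i\sim\mathrm{Gamma}(n_i-1,\sigma_i)$ (shape $n_i-1$, scale $\sigma_i$). The unrestricted best affine equivariant estimator of $\sigma_i$ is the minimum-risk estimator among those of the form $dT_i$, $d$ a constant; it is $d_{0i}T_i$. The risk of an estimator $\delta$ of $\sigma_i$ is $E\,L(\sigma_i,\delta)$; for the estimators here it depends only on $\underline\sigma=(\sigma_1,\dots,\sigma_k)$. An estimator $\delta'$ dominates $\delta$ if its risk is at most that of $\delta$ for every $\underline\sigma$ with $\sigma_1\le\cdots\le\sigma_k$, with strict inequality for at least one such $\underline\sigma$; $\delta$ is inadmissible if some estimator dominates it. *)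

(* Defs.v *)
From HB Require Import structures.
From mathcomp Require Import all_boot all_order all_algebra.
From mathcomp Require Import all_classical all_reals all_analysis.
Import Order.TTheory GRing.Theory Num.Theory.
Import numFieldNormedType.Exports.

Set Implicit Arguments.
Unset Strict Implicit.
Unset Printing Implicit Defensive.

Local Open Scope classical_set_scope.
Local Open Scope ring_scope.

(* The populations 1, ..., k are indexed by 'I_k starting from 0; these are
   populations 1 and 2. *)
Definition pop1 (k : nat) (hk : (2 <= k)%N) : 'I_k := Ordinal (ltnW hk).
Definition pop2 (k : nat) (hk : (2 <= k)%N) : 'I_k := Ordinal hk.

Definition exponential_density (R : realType) (mu sigma x : R) : R :=
  if mu < x then sigma^-1 * expR (- ((x - mu) / sigma)) else 0.

Definition mutually_independent (R : realType) (d : measure_display)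
    (Omega : measurableType d) (P : probability Omega R) (I : finType)
    (Y : I -> Omega -> R) : Prop :=
  forall (J : {set I}) (B : I -> set R),
    (forall i, i \in J -> measurable (B i)) ->
    P [set w | forall i, i \in J -> B i (Y i w)]
    = (\prod_(i in J) P (Y i @^-1` B i))%E.

Definition positive_scales (R : realType) (k : nat) (sigma : 'I_k -> R) : Prop :=
  forall i, 0 < sigma i.

Definition ordered_scales (R : realType) (k : nat) (sigma : 'I_k -> R) : Prop :=
  forall i j : 'I_k, (i <= j)%N -> sigma i <= sigma j.

Section Model.
Variables (R : realType) (k : nat) (n : 'I_k -> nat).

Definition sample : Type := forall i : 'I_k, 'I_(n i) -> R.

(* The parameter space is unrestricted: the order of the scales is imposed only
   when estimators are compared. *)
Definition exponential_model (d : measure_display) (Omega : measurableType d)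
    (X : forall i : 'I_k, 'I_(n i) -> {mfun Omega >-> R})
    (P : ('I_k -> R) -> ('I_k -> R) -> probability Omega R) : Prop :=
  forall mu sigma : 'I_k -> R, positive_scales sigma ->
    (forall (i : 'I_k) (j : 'I_(n i)) (B : set R), measurable B ->
       P mu sigma (X i j @^-1` B)
       = (\int[lebesgue_measure]_(x in B)
            (exponential_density (mu i) (sigma i) x)%:E)%E) /\
    mutually_independent (P mu sigma)
      (fun ij : {i : 'I_k & 'I_(n i)} => X (tag ij) (tagged ij)).

(* The minimum of the i-th sample; the neutral element of the iterated minimum
   is the first observation, so the value is a minimum as soon as 0 < n i. *)
Definition Xmin (i : 'I_k) (x : sample) : R :=
  let s := [seq x i j | j <- enum 'I_(n i)] in
  \big[Num.min/head 0 s]_(y <- s) y.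

Definition T (i : 'I_k) (x : sample) : R := \sum_(j < n i) (x i j - Xmin i x).

(* Equal to 0 where T i x = 0, which has probability 0 in the model. *)
Definition V (i j : 'I_k) (x : sample) : R := T j x / T i x.

Definition equivariant (c : R) (i : 'I_k) (x : sample) : R := c * T i x.

Definition sample_measurable : set (set sample) :=
  <<s \bigcup_(ij in [set: {i : 'I_k & 'I_(n i)}])
        preimage_set_system [set: sample]
          (fun x : sample => x (tag ij) (tagged ij)) measurable >>.

Definition is_estimator (delta : sample -> R) : Prop :=
  forall B : set R, measurable B -> sample_measurable (delta @^-1` B).

Definition linex_loss (p sigma delta : R) : R :=
  expR (p * (delta / sigma - 1)) - p * (delta / sigma - 1) - 1.

Section Risk.
Variables (d : measure_display) (Omega : measurableType d).
Variable X : forall i : 'I_k, 'I_(n i) -> {mfun Omega >-> R}.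
Variable P : ('I_k -> R) -> ('I_k -> R) -> probability Omega R.
Variables (p : R) (i : 'I_k).

(* The loss is nonnegative, so the risk is well defined, possibly infinite. *)
Definition risk (delta : sample -> R) (mu sigma : 'I_k -> R) : \bar R :=
  ('E_(P mu sigma)
     [fun w => linex_loss p (sigma i) (delta (fun a b => X b w))])%E.

(* An arbitrary competitor may have a risk depending on mu as well, so both
   comparisons are required for all locations. *)
Definition dominates (delta' delta : sample -> R) : Prop :=
  [/\ is_estimator delta',
      forall mu sigma : 'I_k -> R,
        positive_scales sigma -> ordered_scales sigma ->
        (risk delta' mu sigma <= risk delta mu sigma)%E &
      exists sigma : 'I_k -> R,
        [/\ positive_scales sigma, ordered_scales sigma &
            forall mu : 'I_k -> R,
              (risk delta' mu sigma < risk delta mu sigma)%E]].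

Definition inadmissible (delta : sample -> R) : Prop :=
  exists delta' : sample -> R, dominates delta' delta.

Definition best_affine_equivariant (c : R) : Prop :=
  forall (c' : R) (mu sigma : 'I_k -> R), positive_scales sigma ->
    (risk (equivariant c i) mu sigma <= risk (equivariant c' i) mu sigma)%E.

End Risk.

Section Constants.
Variable p : R.

Definition d0 (i : 'I_k) : R := p^-1 * (1 - expR (- (p / (n i)%:R))).

Definition e1 (hk : (2 <= k)%N) : R :=
  p^-1 * (1 - expR (- (p / ((n (pop1 hk))%:R + (n (pop2 hk))%:R - 1)))).

Definition e2 : R :=
  p^-1 * (1 - expR (- (p / ((\sum_(j < k) n j)%N%:R - k%:R + 1)))).

Definition improved_first (hk : (2 <= k)%N) (x : sample) : R :=
  let T1 := T (pop1 hk) x in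
  let d01 := d0 (pop1 hk) in
  let a := e1 hk in
  let b := e1 hk * (1 + V (pop1 hk) (pop2 hk) x) in
  if d01 < a then a * T1 else if d01 <= b then d01 * T1 else b * T1.

Definition improved_later (i : 'I_k) (x : sample) : R :=
  let b := e2 * (1 + \sum_(j < k | (j < i)%N) V i j x) in
  if d0 i < b then b * T i x else d0 i * T i x.

End Constants.
End Model.

(* Main.v *)
Require Import Defs.
From HB Require Import structures.
From mathcomp Require Import all_boot all_order all_algebra.
From mathcomp Require Import all_classical all_reals all_analysis.
From mathcomp Require Import measurable_realfun measurable_fun_approximation ring lra.
Import Order.TTheory GRing.Theory Num.Theory.
Import numFieldNormedType.Exports.
Local Open Scope classical_set_scope.
Local Open Scope ring_scope.

(** The linex loss is convex in the estimate, so moving an estimate towards a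
    point beyond which the conditional risk increases can only help. Given all
    ratios of the spacings [T j], the variable [U = \sum_j T j / s j] (over any set
    of populations) is Gamma distributed, and its optimal multiple as an
    estimator of 1 is [e U], with e the constant of the statement for the shape
    at hand. For [j < i] the order of the scales gives
    [e2 (T i + \sum_(j < i) T j) <= s i e2 U], so an estimate of [s i] below the
    left-hand side is too small and should be raised to it; for the first
    population, with U formed from the first two, it gives
    [s 1 e1 U <= e1 (T 1 + T 2)], and an estimate above the right-hand side should
    be lowered to it. A single population gives the optimality of [d0 i T i].

    Neither conditional laws nor densities of the spacings are used. The
    difference between the two estimators is G (T 1, ..., T k), up to sign, with
    G nonnegative and homogeneous of degree 1, and by the tangent inequality for
    the loss it is enough that [(expR (p (e U - 1)) - 1) G] has mean zero
    ([weighted_score], [risk_comparison]). This is an identity between the mean of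
    G and the mean of G tilted by an exponential of U. Tilting divides the scales
    of the populations by a common factor ([law_tilt]), which by homogeneity
    divides the mean of G by that factor ([laplace_homogeneous]).

    A tilt by [T i] comes from the change of scale for a whole exponential sample,
    whose density involves both [T i] and the minimum of the sample. The minimum
    is integrated out because it is independent of the spacings: the law of an
    exponential sample conditioned to exceed a level is the law with shifted
    location, which functions of the spacings cannot distinguish
    ([law_Xmin_tail]).

    Strictness comes from the fact that no positive multiple of one [T i] bounds another
    [T j] from below almost surely ([not_ae_dominated]), so that the truncation is
    active with positive probability. *)

Set Implicit Arguments.
Unset Strict Implicit.
Unset Printing Implicit Defensive.

(** * Densities, uniqueness of measures, independence *)

Section density.
Context d (T : measurableType d) (R : realType) (mu : {measure set T -> \bar R}).
Variable h : T -> R.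
Hypotheses (mh : measurable_fun setT h) (h0 : forall x, 0 <= h x).

(** The measure with density h; the proofs are arguments so that its structure of
    measure can be inferred. *)
Definition weighted of measurable_fun setT h & (forall x, 0 <= h x) :=
  fun A : set T => (\int[mu]_(x in A) (h x)%:E)%E.

Local Notation wmu := (weighted mh h0).

Let weighted0 : wmu set0 = 0%E.
Proof. exact: integral_set0. Qed.

Let weighted_ge0 A : (0 <= wmu A)%E.
Proof. by apply: integral_ge0 => x _; rewrite lee_fin. Qed.

Let weighted_additive : semi_sigma_additive wmu.
Proof.
apply: semi_sigma_additive_nng_induced; first exact/measurable_EFinP.
by move=> x; rewrite lee_fin.
Qed.

HB.instance Definition _ :=
  isMeasure.Build _ _ _ wmu weighted0 weighted_ge0 weighted_additive.

Import HBNNSimple.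

(** True of indicators by assumption, hence of simple functions by linearity, and
    of all nonnegative functions by monotone convergence. *)
Lemma ge0_integral_density (nu : {measure set T -> \bar R}) (f : T -> \bar R) :
    (forall A, measurable A -> nu A = (\int[mu]_(x in A) (h x)%:E)%E) ->
    measurable_fun setT f -> (forall x, (0 <= f x)%E) ->
  (\int[nu]_x f x = \int[mu]_x (f x * (h x)%:E))%E.
Proof.
move=> nuE mf f0; pose f_ := nnsfun_approx measurableT mf.
have f_cvg x : (f_ n x)%:E @[n --> \oo] --> f x.
  by apply: cvg_nnsfun_approx => //= y _; exact: f0.
have f_nd x m n : (m <= n)%N -> f_ m x <= f_ n x.
  by move=> mn; exact/lefP/nd_nnsfun_approx.
transitivity (limn (fun n => \int[nu]_x (f_ n x)%:E)%E).
  rewrite -monotone_convergence//.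
  - by apply: eq_integral => x _; apply/esym/cvg_lim.
  - by move=> n; exact/measurable_EFinP/measurable_funP.
  - by move=> n x _; rewrite lee_fin.
  - by move=> x _ m n mn; rewrite lee_fin f_nd.
transitivity (limn (fun n => \int[mu]_x ((f_ n x)%:E * (h x)%:E))%E); last first.
  rewrite -monotone_convergence//.
  - apply: eq_integral => x _; apply/cvg_lim => //.
    under eq_fun do rewrite muleC.
    by rewrite muleC; apply: cvgeZl.
  - by move=> n; apply: emeasurable_funM; apply/measurable_EFinP => //.
  - by move=> n x _; rewrite mule_ge0 ?lee_fin.
  - by move=> x _ m n mn; rewrite lee_wpmul2r ?lee_fin ?f_nd.
congr (limn _); apply/funext => n.
transitivity (\sum_(k \in range (f_ n))
    \int[nu]_x (k * \1_(f_ n @^-1` [set k]) x)%:E)%E.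
  under eq_integral do rewrite fimfunE -fsumEFin//.
  rewrite ge0_integral_fsum//.
  - by move=> y; exact/measurable_EFinP/measurable_funM.
  - by move=> y x _; rewrite nnfun_muleindic_ge0.
transitivity (\sum_(k \in range (f_ n))
    \int[mu]_x ((k * \1_(f_ n @^-1` [set k]) x)%:E * (h x)%:E))%E; last first.
  rewrite -ge0_integral_fsum//.
  - apply: eq_integral => x _.
    by rewrite -ge0_mule_fsuml ?fsumEFin -?fimfunE// => r; rewrite nnfun_muleindic_ge0.
  - by move=> y; apply: emeasurable_funM; apply/measurable_EFinP => //; exact: measurable_funM.
  - by move=> y x _; rewrite mule_ge0 ?nnfun_muleindic_ge0 ?lee_fin.
apply: eq_fsbigr => r /[!inE] -[z _ fz].
have mA : measurable (f_ n @^-1` [set r]) by exact: measurable_sfunP.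
have r0 : (0 <= r)%R by rewrite -fz.
under eq_integral do rewrite EFinM.
rewrite ge0_integralZl//; last 1 first.
  exact/measurable_EFinP.
under [RHS]eq_integral do rewrite EFinM -muleA.
rewrite [RHS]ge0_integralZl//; last 2 first.
  by apply: emeasurable_funM; apply/measurable_EFinP.
  by move=> x _; rewrite mule_ge0 ?lee_fin.
congr (_ * _)%E; rewrite integral_indic// setIT nuE// [LHS]integral_mkcond.
apply: eq_integral => x _; rewrite patchE indicE.
by case: ifP => _; rewrite ?mul1e ?mul0e.
Qed.

End density.

(** Rays form a pi-system that generates the Borel sets. *)
Lemma measure_eq_rays (R : realType) (m1 m2 : {measure set R -> \bar R}) :
    (forall a, m1 `]a, +oo[%classic = m2 `]a, +oo[%classic) ->
    (forall a, (m1 `]a, +oo[%classic < +oo)%E) ->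
  forall A, measurable A -> m1 A = m2 A.
Proof.
move=> m12 m1oo; apply: (measure_unique [set `]a, +oo[%classic | a in [set: R]]
  (fun n => `](- n%:R)%R, +oo[%classic)).
- rewrite [LHS]RGenOInfty.measurableE; congr (<<s _ >>).
  by apply/seteqP; split=> [_ [x ->]|_ [x _ <-]]; exists x.
- move=> _ _ [a _ <-] [b _ <-]; exists (Num.max a b) => //.
  apply/seteqP; split=> x /=; rewrite !in_itv/= !andbT gt_max; first by move=> /andP.
  by move=> [-> ->].
- by move=> n; exists (- n%:R).
- apply/seteqP; split=> // x _; exists (Num.bound `|x|) => //=.
  by rewrite in_itv/= andbT ltrNl (le_lt_trans _ (archi_boundP (normr_ge0 x)))// lerNl lerNnormlW.
- by move=> _ [a _ <-]; exact: m12.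
- by move=> n; exact: m1oo.
Qed.

Lemma integral_indic_comp (R : realType) d (Omega : measurableType d)
    (mu : {measure set Omega -> \bar R}) (Y : Omega -> R) (B : set R) :
    measurable_fun setT Y -> measurable B ->
  (\int[mu]_w (\1_B (Y w))%:E = mu (Y @^-1` B))%E.
Proof.
move=> mY mB; have mYB : measurable (Y @^-1` B).
  by rewrite -[X in measurable X]setTI; exact: mY.
by rewrite -[in RHS](setIT (Y @^-1` B)) -integral_indic.
Qed.

Section product_expectation.
Context (R : realType) d (Omega : measurableType d) (P : probability Omega R).
Context (I : finType) (Y : I -> Omega -> R).
Hypothesis mY : forall i, measurable_fun setT (Y i).
Hypothesis indY : mutually_independent P Y.

(** Independence is stated on events, that is for indicators; the factors are
    replaced one at a time by arbitrary functions, both sides being integrals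
    of the new factor against measures that agree on all sets. In the induction,
    the factors with index outside s are still indicators. *)
Lemma independent_expectation_prod (f : I -> R -> R) (e : I -> R) :
    (forall i, measurable_fun setT (f i)) -> (forall i x, 0 <= f i x) ->
    (forall i, \int[P]_w (f i (Y i w))%:E = (e i)%:E)%E ->
  (\int[P]_w (\prod_i f i (Y i w))%:E = (\prod_i e i)%:E)%E.
Proof.
suff H (s : seq I) : forall (f : I -> R -> R) (e : I -> R),
    (forall i, measurable_fun setT (f i)) -> (forall i x, 0 <= f i x) ->
    (forall i, \int[P]_w (f i (Y i w))%:E = (e i)%:E)%E ->
    (forall i, i \notin s -> exists2 B, measurable B & f i = \1_B) ->
    (\int[P]_w (\prod_i f i (Y i w))%:E = (\prod_i e i)%:E)%E.
  by move=> mf f0 fe; apply: (H (enum I)) => // i; rewrite mem_enum.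
elim: s => [|a s IH] {}f {}e mf f0 fe fs.
  have /choice[B HB] i : exists B, measurable B /\ f i = \1_B.
    by have [//|B mB fB] := fs i; exists B.
  have := indY (J := [set: I]%SET) (fun i _ => (HB i).1).
  under [X in _ = X -> _]eq_bigl do rewrite inE.
  have fP i : P (Y i @^-1` B i) = (e i)%:E.
    by rewrite -fe (HB i).2 integral_indic_comp//; exact: (HB i).1.
  under [X in _ = X -> _]eq_bigr do rewrite fP.
  rewrite prodEFin => <-.
  set S := [set w | _].
  have mS : measurable S.
    have -> : S = \bigcap_(i in [set: I]) (Y i @^-1` B i).
      by apply/seteqP; split=> w /= wS i; [move=> _|move=> _]; apply: wS; rewrite ?inE.
    apply: fin_bigcap_measurable => // i _.
    by rewrite -[X in measurable X]setTI; apply: mY => //; exact: (HB i).1.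
  rewrite -[in RHS](setIT S) -integral_indic//.
  apply: eq_integral => w _; congr EFin; rewrite indicE.
  have [wS|wS] := boolP (w \in S).
    apply: big1 => i _; rewrite (HB i).2 indicE mem_set//.
    by move: wS; rewrite inE; apply; rewrite inE.
  have /existsNP[i /not_implyP[_ Bi]] : ~ S w by move: wS; rewrite notin_setE.
  by rewrite (bigD1 i)//= (HB i).2 indicE memNset// mul0r.
have e0 i : 0 <= e i.
  by rewrite -lee_fin -fe integral_ge0// => w _; rewrite lee_fin.
pose h w := \prod_(i | i != a) f i (Y i w).
pose c := \prod_(i | i != a) e i.
have h0 w : 0 <= h w by exact: prodr_ge0.
have c0 : 0 <= c by exact: prodr_ge0.
have mh : measurable_fun setT h.
  rewrite /h; under eq_fun do rewrite big_mkcond.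
  apply: measurable_prod => i _; have [_|_] := eqVneq i a; first exact: measurable_cst.
  exact: measurableT_comp.
have mhE B : measurable B ->
    pushforward (weighted P mh h0) (Y a) B = mscale (NngNum c0) (pushforward P (Y a)) B.
  move=> mB; pose g i := if i == a then \1_B else f i.
  have := IH g (fun i => if i == a then fine (P (Y a @^-1` B)) else e i).
  have mYB : measurable (Y a @^-1` B).
    by rewrite -[X in measurable X]setTI; exact: mY.
  rewrite (bigD1 a)//= eqxx.
  rewrite /mscale/= /pushforward/weighted.
  have -> : (\int[P]_(x in Y a @^-1` B) (h x)%:E = \int[P]_w (\prod_i g i (Y i w))%:E)%E.
    rewrite [LHS]integral_mkcond; apply: eq_integral => w _.
    rewrite (bigD1 a)//= {1}/g eqxx patchE indicE.
    have -> : (Y a w \in B) = (w \in Y a @^-1` B) by apply/idP/idP; rewrite !inE.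
    case: ifP => wB; rewrite ?mul1r ?mul0r//; congr EFin.
    by apply: eq_bigr => i /negPf; rewrite /g => ->.
  move=> ->.
  - rewrite EFinM fineK ?fin_num_measure// muleC; congr (_%:E * _)%E.
    by apply: eq_bigr => i /negPf ->.
  - by move=> i; rewrite /g; case: eqP => // _; exact: measurable_indic.
  - by move=> i x; rewrite /g; case: eqP => // _; rewrite indicE.
  - move=> i; rewrite /g; case: eqP => [->|//].
    by rewrite integral_indic_comp// fineK// fin_num_measure.
  - move=> i; rewrite /g; have [_ _|ia i_s] := eqVneq i a; first by exists B.
    by apply: fs; rewrite inE (negPf ia).
transitivity (\int[pushforward (weighted P mh h0) (Y a)]_x (f a x)%:E)%E.
  rewrite ge0_integral_pushforward//=; last 2 first.
    exact/measurable_EFinP.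
    by move=> x _; rewrite lee_fin.
  rewrite preimage_setT [RHS](@ge0_integral_density _ _ _ P h mh h0 (weighted P mh h0))//=.
  - by apply: eq_integral => w _; rewrite (bigD1 a)//= EFinM.
  - by apply/measurable_EFinP; exact: measurableT_comp.
  - by move=> x; rewrite lee_fin.
rewrite (eq_measure_integral (mscale (NngNum c0) (pushforward P (Y a))))/=; last first.
  by move=> B mB _; exact: mhE.
rewrite ge0_integral_mscale//=; last 2 first.
  exact/measurable_EFinP.
  by move=> x _; rewrite lee_fin.
rewrite ge0_integral_pushforward//=; last 2 first.
  exact/measurable_EFinP.
  by move=> x _; rewrite lee_fin.
by rewrite preimage_setT fe (bigD1 a)//= mulrC EFinM.
Qed.
End product_expectation.

(** * The sample space *)

Section sample_space.
Variables (R : realType) (k : nat) (n : 'I_k -> nat).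

HB.instance Definition _ := gen_eqMixin (sample R n).
HB.instance Definition _ := gen_choiceMixin (sample R n).
HB.instance Definition _ := isPointed.Build (sample R n) (fun _ _ => 0).

Definition coordinate_sets : set (set (sample R n)) :=
  \bigcup_(ij in [set: {i : 'I_k & 'I_(n i)}])
    preimage_set_system [set: sample R n]
      (fun x : sample R n => x (tag ij) (tagged ij)) measurable.

Definition sample_space := g_sigma_algebraType coordinate_sets.
HB.instance Definition _ := Measurable.on sample_space.

Lemma is_estimatorP (delta : sample R n -> R) :
  measurable_fun setT (delta : sample_space -> R) -> is_estimator delta.
Proof. by move=> mdelta B mB; have := mdelta measurableT B mB; rewrite setTI. Qed.

Lemma measurable_coordinate i j :
  measurable_fun setT (fun x : sample_space => x i j).
Proof.
move=> _ B mB; apply: sub_sigma_algebra.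
by exists (existT _ i j) => //; exists B.
Qed.

Lemma measurable_into_sample d (Omega : measurableType d) (f : Omega -> sample_space) :
  (forall i j, measurable_fun setT (fun w => f w i j)) -> measurable_fun setT f.
Proof.
move=> mf; apply: (@measurability _ _ _ sample_space setT f coordinate_sets) => //.
move=> _ [_ [[i j] _ [B mB <-]] <-].
by rewrite !setTI; have := mf i j measurableT B mB; rewrite setTI.
Qed.

Definition box (B : {i : 'I_k & 'I_(n i)} -> set R) : set sample_space :=
  [set x | forall ij, B ij (x (tag ij) (tagged ij))].

Lemma measurable_box B : (forall ij, measurable (B ij)) -> measurable (box B).
Proof.
move=> mB.
have -> : box B = \bigcap_(ij in setT)
    ((fun x : sample_space => x (tag ij) (tagged ij)) @^-1` B ij).
  by apply/seteqP; split=> x /= xB ij; [move=> _|]; exact: xB.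
apply: fin_bigcap_measurable => [|ij _].
  exact: (@finite_finset {i : 'I_k & 'I_(n i)}).
by have := @measurable_coordinate (tag ij) (tagged ij) measurableT _ (mB ij); rewrite setTI.
Qed.

(** Boxes are a pi-system, so that they determine finite measures. *)
Lemma measure_eq_boxes (m1 m2 : {measure set sample_space -> \bar R}) :
    (forall B, (forall ij, measurable (B ij)) -> m1 (box B) = m2 (box B)) ->
    (m1 setT < +oo)%E ->
  forall A, measurable A -> m1 A = m2 A.
Proof.
move=> m12 m1T A mA.
pose G := [set box B | B in [set B | forall ij, measurable (B ij)]].
have GT : G setT by exists (fun=> setT); [move=> ? /=|apply/seteqP; split].
apply: (@g_sigma_algebra_measure_unique _ _ _ G _ (fun=> setT)) => //.
- by move=> _ [B mB <-]; exact: measurable_box.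
- by apply/seteqP; split=> // x _; exists 0%N.
- move=> _ _ [B mB <-] [C mC <-]; exists (fun ij => B ij `&` C ij).
    by move=> ij; exact: measurableI (mB ij) (mC ij).
  by apply/seteqP; split=> x /=; [move=> BC; split=> ij; have [] := BC ij|move=> [HB HC] ij].
- by move=> _ [B mB <-]; exact: m12.
- apply: smallest_sub mA; first exact: smallest_sigma_algebra.
  move=> _ [ij _ [B mB <-]]; apply: sub_sigma_algebra.
  exists (fun ij' => if ij' == ij then B else setT).
    by move=> ij' /=; case: ifP.
  apply/seteqP; split=> x /=; first by move=> /(_ ij); rewrite eqxx.
  by move=> [_ Bx] ij'; case: eqP => // ->.
Qed.

End sample_space.

(** * Exponential laws *)

Section exponential_density.
Context (R : realType).

Lemma exponential_density_ge0 (mu s x : R) : 0 < s -> 0 <= exponential_density mu s x.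
Proof.
move=> s0; rewrite /exponential_density; case: ifP => // _.
by rewrite mulr_ge0 ?expR_ge0// invr_ge0 ltW.
Qed.

Lemma measurable_exponential_density (mu s : R) :
  measurable_fun setT (exponential_density mu s).
Proof.
apply: measurable_fun_ifT => //; first exact: measurable_fun_ltr.
apply: measurable_funM => //; apply: measurableT_comp => //.
apply: measurable_funN; apply: measurable_funM => //; exact: measurable_funB.
Qed.

End exponential_density.

Section model.
Context (R : realType) (k : nat) (n : 'I_k -> nat).
Context (d : measure_display) (Omega : measurableType d).
Context (X : forall i : 'I_k, 'I_(n i) -> {mfun Omega >-> R}).
Context (P : ('I_k -> R) -> ('I_k -> R) -> probability Omega R).
Hypothesis hP : exponential_model X P.
Arguments X : clear implicits.

Implicit Types (mu s : 'I_k -> R).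

Lemma observation_law mu s i j (B : set R) : positive_scales s -> measurable B ->
  P mu s (X i j @^-1` B) =
  (\int[lebesgue_measure]_(x in B) (exponential_density (mu i) (s i) x)%:E)%E.
Proof. by move=> s0 mB; have [+ _] := @hP mu s s0; apply. Qed.

Lemma integral_observation mu s i j (g : R -> \bar R) : positive_scales s ->
    measurable_fun setT g -> (forall x, (0 <= g x)%E) ->
  (\int[P mu s]_w g (X i j w) =
   \int[lebesgue_measure]_x (g x * (exponential_density (mu i) (s i) x)%:E))%E.
Proof.
move=> s0 mg g0; have mX : measurable_fun setT (X i j : Omega -> measurableTypeR R).
  have := @measurable_funPT _ _ _ _ (X i j). exact.
rewrite -(@ge0_integral_density _ _ _ lebesgue_measure
  _ (measurable_exponential_density (mu i) (s i))
  (fun x => exponential_density_ge0 _ _ (s0 i))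
  (pushforward (P mu s) (X i j : Omega -> measurableTypeR R)))//.
  by rewrite ge0_integral_pushforward.
by move=> A mA; rewrite -(observation_law mu j s0).
Qed.

(** Beyond a, the density is a multiple of the exponential density with location
    a, whose total mass is 1. *)
Lemma tail_observation mu s i (j : 'I_(n i)) a : positive_scales s ->
  (P mu s (X i j @^-1` `]a, +oo[%classic) =
   (expR (- Num.max 0 ((a - mu i) / s i)))%:E)%E.
Proof.
move=> s0.
have tot b : (\int[lebesgue_measure]_(x in `]b, +oo[%classic)
    (exponential_density b (s i) x)%:E = 1 :> \bar R)%E.
  have := observation_law (fun=> b) j s0 measurableT.
  rewrite preimage_setT probability_setT => ->.
  rewrite [LHS]integral_mkcond; apply: eq_integral => x _.
  rewrite patchE; case: ifPn => //; rewrite notin_setE/= in_itv/= andbT => /negP bx.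
  by rewrite /exponential_density ifN.
rewrite observation_law//.
have [amu|mua] := leP a (mu i).
  rewrite max_l; last by rewrite mulr_le0_ge0 ?subr_le0// invr_ge0 ltW.
  rewrite oppr0 expR0 -(tot (mu i)) integral_mkcond [RHS]integral_mkcond.
  apply: eq_integral => x _; rewrite !patchE !mem_setE !in_itv/= !andbT.
  have [mx|xm] := ltP (mu i) x; first by rewrite (le_lt_trans amu mx).
  have -> : exponential_density (mu i) (s i) x = 0 by rewrite /exponential_density ltNge xm.
  by case: ifP.
rewrite max_r; last by rewrite divr_ge0// ?subr_ge0 ltW.
rewrite -[RHS]mule1 -(tot a) -ge0_integralZl//; last 2 first.
- by apply: measurable_funTS; apply/measurable_EFinP; exact: measurable_exponential_density.
- by move=> x _; rewrite lee_fin exponential_density_ge0.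
apply: eq_integral => x; rewrite inE/= in_itv/= andbT => ax.
rewrite /exponential_density ax (lt_trans mua ax) -EFinM; congr EFin.
rewrite mulrCA -expRD; congr (_ * expR _).
by field; rewrite gt_eqF.
Qed.

Lemma affine_observation mu mu' s lam i (j : 'I_(n i)) (B : set R) :
    positive_scales s -> 0 < lam i -> positive_scales (fun i => lam i * s i) ->
    measurable B ->
  P mu s [set w | B (lam i * (X i j w - mu i) + mu' i)] =
  P mu' (fun i => lam i * s i) (X i j @^-1` B).
Proof.
move=> s0 l0 ls0 mB.
pose phi x := lam i * (x - mu i) + mu' i.
have mphi : measurable_fun setT (phi \o X i j).
  apply: measurable_funD => //; apply: measurable_funM => //.
  exact: measurable_funB.
pose m1 := pushforward (P mu s) (phi \o X i j).
pose m2 := pushforward (P mu' (fun i => lam i * s i)) (X i j).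
have /(_ mphi) : forall (m : measurable_fun setT (phi \o X i j)), m1 B = m2 B.
  move=> m; apply: measure_eq_rays mB => a.
    change (P mu s ((phi \o X i j) @^-1` `]a, +oo[%classic) =
      P mu' (fun i => lam i * s i) (X i j @^-1` `]a, +oo[%classic)).
    rewrite tail_observation//.
    transitivity (P mu s (X i j @^-1` `](mu i + (a - mu' i) / lam i), +oo[%classic)).
      congr (P mu s _); apply/seteqP; split=> w /=; rewrite !in_itv/= !andbT /phi.
        by rewrite -ltrBlDr mulrC -ltr_pdivrMr// ltrBrDl.
      by rewrite -ltrBrDl ltr_pdivrMr// mulrC ltrBlDr.
    rewrite tail_observation//; congr (expR (- Num.max _ _))%:E.
    by field; rewrite !gt_eqF//=; exact: s0.
  change (P mu s ((phi \o X i j) @^-1` `]a, +oo[%classic) < +oo)%E.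
  rewrite (le_lt_trans (probability_le1 _ _)) ?ltry//.
  by rewrite -[X in measurable X]setTI; apply: mphi.
by [].
Qed.

Lemma reweighted_observation mu mu' s s' (rho : R -> R) i (j : 'I_(n i)) (B : set R) :
    positive_scales s -> positive_scales s' ->
    measurable_fun setT rho -> (forall x, 0 <= rho x) ->
    (forall x, rho x * exponential_density (mu i) (s i) x =
       exponential_density (mu' i) (s' i) x) ->
    measurable B ->
  (\int[P mu s]_w (\1_B (X i j w) * rho (X i j w))%:E = P mu' s' (X i j @^-1` B))%E.
Proof.
move=> s0 s'0 mrho rho0 rhoE mB.
rewrite (@integral_observation _ _ _ _ (fun x => (\1_B x * rho x)%:E))//; last 2 first.
- by apply/measurable_EFinP; apply: measurable_funM.
- by move=> x; rewrite lee_fin mulr_ge0.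
rewrite observation_law// [RHS]integral_mkcond.
apply: eq_integral => x _; rewrite -EFinM -mulrA rhoE patchE indicE.
by case: ifP => _; rewrite ?mul1r ?mul0r.
Qed.

End model.

Section law.
Context (R : realType) (k : nat) (n : 'I_k -> nat).
Context (d : measure_display) (Omega : measurableType d).
Context (X : forall i : 'I_k, 'I_(n i) -> {mfun Omega >-> R}).
Arguments X : clear implicits.

Let observe (w : Omega) : sample_space R n := fun i j => X i j w.

Let measurable_observe : measurable_fun setT observe.
Proof. by apply: measurable_into_sample => i j; exact: measurable_funPT. Qed.

Definition observed : {mfun Omega >-> sample_space R n} :=
  HB.pack observe (isMeasurableFun.Build _ _ _ _ observe measurable_observe).

Context (P : ('I_k -> R) -> ('I_k -> R) -> probability Omega R).

Definition law (mu s : 'I_k -> R) : probability (sample_space R n) R :=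
  distribution (P mu s) observed.

Lemma ge0_integral_law mu s (F : sample_space R n -> \bar R) :
    measurable_fun setT F -> (forall x, (0 <= F x)%E) ->
  (\int[law mu s]_x F x = \int[P mu s]_w F (observed w))%E.
Proof. by move=> mF F0; rewrite /law ge0_integral_distribution. Qed.

Hypothesis hP : exponential_model X P.

(** Laws of the sample are determined by the joint probabilities of events about
    single observations, where independence makes the coordinates decouple; so a
    change of variables and density that acts on each observation separately
    only has to be checked for one observation. *)
Lemma change_of_law mu s mu' s' (phi rho : 'I_k -> R -> R)
    (F : sample_space R n -> R) :
    positive_scales s -> positive_scales s' ->
    (forall i, measurable_fun setT (phi i)) ->
    (forall i, measurable_fun setT (rho i)) -> (forall i x, 0 <= rho i x) ->
    (forall i (j : 'I_(n i)) B, measurable B ->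
      (\int[P mu s]_w (\1_B (phi i (X i j w)) * rho i (X i j w))%:E =
       P mu' s' (X i j @^-1` B))%E) ->
    measurable_fun setT F -> (forall x, 0 <= F x) ->
  (\int[law mu' s']_x (F x)%:E =
   \int[law mu s]_x (F (fun i j => phi i (x i j)) *
                     \prod_i \prod_(j < n i) rho i (x i j))%:E)%E.
Proof.
move=> s0 s'0 mphi mrho rho0 H mF F0.
pose I := {i : 'I_k & 'I_(n i)}.
pose Phi (x : sample_space R n) : sample_space R n := fun i j => phi i (x i j).
pose r (x : sample_space R n) := \prod_i \prod_(j < n i) rho i (x i j).
have r0 x : 0 <= r x by apply: prodr_ge0 => i _; exact: prodr_ge0.
have mr : measurable_fun setT r.
  apply: measurable_prod => i _; apply: measurable_prod => j _.
  by apply: measurableT_comp => //; exact: measurable_coordinate.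
have mPhi : measurable_fun setT Phi.
  apply: measurable_into_sample => i j.
  by apply: (measurableT_comp (mphi i)); exact: measurable_coordinate.
pose m1 := pushforward (weighted (law mu s) mr r0) Phi.
have mFE : measurable_fun setT (EFin \o F) by exact/measurable_EFinP.
have /(_ mPhi) E12 : forall (m : measurable_fun setT Phi) A, measurable A ->
    law mu' s' A = m1 A.
  move=> m; apply: measure_eq_boxes; last first.
    have lT : law mu' s' setT = 1%E by exact: probability_setT.
    by apply: (@le_lt_trans _ _ 1%E); rewrite ?ltry// -lT.
  move=> B mB.
  change (P mu' s' (observed @^-1` box B) =
    (\int[law mu s]_(x in Phi @^-1` box B) (r x)%:E)%E).
  have [_ ind'] := @hP mu' s' s'0.
  have := ind' [set: I]%SET B (fun ij _ => mB ij).
  have -> : [set w | forall i, i \in [set: I]%SET -> B i (X (tag i) (tagged i) w)]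
          = observed @^-1` box B.
    by apply/seteqP; split=> w /= HB ij; [|move=> _]; apply: HB; rewrite ?inE.
  move=> ->.
  pose f (ij : I) x := \1_(B ij) (phi (tag ij) x) * rho (tag ij) x.
  have [_ ind] := @hP mu s s0.
  have mP ij : measurable (X (tag ij) (tagged ij) @^-1` B ij).
    by rewrite -[X in measurable X]setTI; exact: measurable_funPT.
  have := @independent_expectation_prod _ _ _ _ _ _ _ ind f
    (fun ij => fine (P mu' s' (X (tag ij) (tagged ij) @^-1` B ij))).
  move=> E; transitivity (\prod_(ij : I)
      fine (P mu' s' (X (tag ij) (tagged ij) @^-1` B ij)))%:E.
    rewrite -prodEFin; apply: eq_big => [ij|ij _]; first by rewrite inE.
    by rewrite fineK// fin_num_measure.
  rewrite -E; last 4 first.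
  - by move=> ij; exact: measurable_funPT.
  - move=> ij; apply: measurable_funM => //.
    by apply: measurableT_comp => //; exact: mphi.
  - by move=> ij x; rewrite mulr_ge0.
  - by move=> ij; rewrite H// fineK// fin_num_measure.
  rewrite [RHS]integral_mkcond ge0_integral_law; last 2 first.
  - apply/(measurable_restrictT _ _).1; last exact/measurable_EFinP/measurable_funTS.
    by rewrite -[X in measurable X]setTI; apply: mPhi => //; exact: measurable_box.
  - by apply: erestrict_ge0 => x _; rewrite lee_fin.
  apply: eq_integral => w _; rewrite patchE.
  have rE : r (observed w) = \prod_(ij : I) rho (tag ij) (X (tag ij) (tagged ij) w).
    by rewrite /r sig_big_dep.
  have [wB|wB] := boolP (_ \in _).
    rewrite rE; congr EFin; apply: eq_bigr => ij _.
    by rewrite /f indicE mem_set ?mul1r//; move: wB; rewrite inE; apply.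
  have /existsNP[ij Bij] : ~ box B (Phi (observed w)) by move: wB; rewrite notin_setE.
  by rewrite (bigD1 ij)//= /f indicE memNset// !mul0r.
rewrite (eq_measure_integral m1)/=; last by move=> A mA _; exact: E12.
transitivity (\int[weighted (law mu s) mr r0]_x (F (Phi x))%:E)%E.
  by rewrite /m1 ge0_integral_pushforward//= => x _; rewrite lee_fin.
rewrite (@ge0_integral_density _ _ _ (law mu s) r mr r0 (weighted (law mu s) mr r0))//=.
- by apply/measurable_EFinP/measurableT_comp.
- by move=> x; rewrite lee_fin.
Qed.

End law.

(** * Minima and spacings *)

Lemma bigmin_seqP (R : realType) (x0 : R) (s : seq R) :
  let m := \big[Num.min/x0]_(y <- s) y in
  (forall y, y \in s -> m <= y) /\ m \in x0 :: s.
Proof.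
elim: s => [|a s [IHle IHin]] /=.
  by rewrite big_nil mem_head.
rewrite big_cons; set m := (X in Num.min a X) in IHle IHin *; split.
  move=> y; rewrite inE ge_min => /orP[/eqP ->|/IHle ->]; first by rewrite lexx.
  by rewrite orbT.
have [am|ma] := leP a m; first by rewrite !inE eqxx orbT.
by move: IHin; rewrite !inE => /orP[->//|->]; rewrite !orbT.
Qed.

Section minima.
Context (R : realType) (k : nat) (n : 'I_k -> nat) (i : 'I_k).
Hypothesis ni0 : (0 < n i)%N.
Implicit Types x : sample R n.

Lemma Xmin_le x j : Xmin i x <= x i j.
Proof.
have [+ _] := bigmin_seqP (head 0 [seq x i j | j <- enum 'I_(n i)]) [seq x i j | j <- enum 'I_(n i)].
by apply; apply: map_f; rewrite mem_enum.
Qed.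

Lemma Xmin_attained x : exists j, Xmin i x = x i j.
Proof.
rewrite /Xmin; set s := map _ _.
have sn0 : head 0 s \in s.
  have : size s = n i by rewrite size_map size_enum_ord.
  case: s ni0 => [|y s'] /=; first by move=> + ss; rewrite -ss.
  by rewrite mem_head.
have [_] := bigmin_seqP (head 0 s) s; rewrite inE => ms.
have /mapP[j _ ->] : \big[Num.min/head 0 s]_(y <- s) y \in s.
  by move: ms => /orP[/eqP ->|].
by exists j.
Qed.

Lemma lt_Xmin x a : (a < Xmin i x) = [forall j, a < x i j].
Proof.
apply/idP/forallP => [ax j|ax]; first exact: lt_le_trans ax (Xmin_le x j).
by have [j ->] := Xmin_attained x.
Qed.

Lemma Xmin_affine x (lam c : 'I_k -> R) : 0 < lam i ->
  Xmin i (fun i j => lam i * x i j + c i) = lam i * Xmin i x + c i.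
Proof.
move=> l0; set y : sample R n := fun i j => _.
apply/eqP; rewrite eq_le; apply/andP; split.
  have [j ->] := Xmin_attained x; exact: (Xmin_le y j).
have [j ->] := Xmin_attained y.
by rewrite /y lerD2r ler_pM2l// Xmin_le.
Qed.

Lemma T_affine x (lam c : 'I_k -> R) : 0 < lam i ->
  T i (fun i j => lam i * x i j + c i) = lam i * T i x.
Proof.
move=> l0; rewrite /T Xmin_affine// mulr_sumr; apply: eq_bigr => j _.
by ring.
Qed.

Lemma T_ge0 x : 0 <= T i x.
Proof. by apply: sumr_ge0 => j _; rewrite subr_ge0 Xmin_le. Qed.

Lemma sum_observations x a :
  \sum_(j < n i) (x i j - a) = T i x + (n i)%:R * (Xmin i x - a).
Proof.
rewrite /T mulr_natl -[X in _ *+ X](card_ord (n i)) -sumr_const -big_split/=.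
by apply: eq_bigr => j _; ring.
Qed.

Lemma measurable_Xmin : measurable_fun setT (Xmin i : sample_space R n -> R).
Proof.
have mh : measurable_fun setT (fun x : sample_space R n =>
    head 0 [seq x i j | j <- enum 'I_(n i)]).
  case: (enum 'I_(n i)) => [|j r] /=; first exact: measurable_cst.
  exact: measurable_coordinate.
suff H h : measurable_fun setT h ->
    measurable_fun setT (fun x : sample_space R n =>
      \big[Num.min/h x]_(j <- enum 'I_(n i)) x i j).
  by rewrite /Xmin; under eq_fun do rewrite big_map; exact: H mh.
move=> {}mh; elim: (enum 'I_(n i)) => [|j r IH].
  by under eq_fun do rewrite big_nil.
under eq_fun do rewrite big_cons.
by apply: measurable_minr => //; exact: measurable_coordinate.
Qed.

Lemma measurable_T : measurable_fun setT (T i : sample_space R n -> R).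
Proof.
apply: measurable_sum => j; apply: measurable_funB; last exact: measurable_Xmin.
exact: measurable_coordinate.
Qed.

End minima.

(** * The law of the spacings *)

(** Used to pass from integrable to arbitrary nonnegative functions. *)
Lemma integral_truncation (R : realType) d (T : measurableType d)
    (mu : {measure set T -> \bar R}) (f g : T -> R) :
    measurable_fun setT f -> measurable_fun setT g ->
    (forall x, 0 <= f x) -> (forall x, 0 <= g x) ->
  (\int[mu]_x (f x * g x)%:E =
   limn (fun N : nat => \int[mu]_x (Num.min (f x) N%:R * g x)%:E))%E.
Proof.
move=> mf mg f0 g0; have h0 N x : 0 <= Num.min (f x) N%:R by rewrite le_min f0/=.
rewrite -monotone_convergence//.
- apply: eq_integral => x _; apply/esym/cvg_lim => //.
  apply: cvg_near_cst; exists (Num.bound (f x)) => // N fN.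
  by rewrite min_l// ltW// (lt_le_trans (archi_boundP (f0 x)))// ler_nat; exact: fN.
- move=> N; apply/measurable_EFinP; apply: measurable_funM => //.
  exact: measurable_minr.
- by move=> N x _; rewrite lee_fin mulr_ge0.
- move=> x _ m N mN; rewrite lee_fin ler_wpM2r//.
  by rewrite le_min !ge_min lexx/= ler_nat mN orbT.
Qed.

Section spacings.
Context (R : realType) (k : nat) (n : 'I_k -> nat).
Hypothesis n_gt0 : forall i, (0 < n i)%N.
Context (d : measure_display) (Omega : measurableType d).
Context (X : forall i : 'I_k, 'I_(n i) -> {mfun Omega >-> R}).
Arguments X : clear implicits.
Context (P : ('I_k -> R) -> ('I_k -> R) -> probability Omega R).
Hypothesis hP : exponential_model X P.

Local Notation law := (law X P).
Local Notation S := (sample_space R n).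
Implicit Types (mu s : 'I_k -> R) (x : S) (H : ('I_k -> R) -> R).

Lemma affine_law mu mu' s lam (F : S -> R) :
    positive_scales s -> positive_scales lam ->
    measurable_fun setT F -> (forall x, 0 <= F x) ->
  (\int[law mu' (fun i => lam i * s i)%R]_x (F x)%:E =
   \int[law mu s]_x (F (fun i j => lam i * x i j + (mu' i - lam i * mu i))%R)%:E)%E.
Proof.
move=> s0 l0 mF F0.
have ls0 : positive_scales (fun i => lam i * s i) by move=> i; rewrite mulr_gt0// l0.
rewrite (change_of_law hP (mu := mu) (s := s)
  (phi := fun i y => lam i * y + (mu' i - lam i * mu i)) (rho := fun _ _ => 1))//.
- apply: eq_integral => x _; rewrite big1 ?mulr1// => i _; exact: big1.
- by move=> i; apply: measurable_funD => //; exact: measurable_funM.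
- move=> i j B mB; under eq_integral do rewrite mulr1.
  rewrite (integral_indic_comp _ (Y := fun w => lam i * X i j w + (mu' i - lam i * mu i)))//.
    rewrite -(@affine_observation _ _ _ _ _ _ _ hP mu mu' s lam i j B s0 (l0 i) ls0 mB).
    congr (P mu s _); apply/seteqP; split=> w /=; congr (B _); ring.
  by apply: measurable_funD => //; exact: measurable_funM.
Qed.

Lemma reweighted_law mu mu' s s' (rho : 'I_k -> R -> R) (F : S -> R) :
    positive_scales s -> positive_scales s' ->
    (forall i, measurable_fun setT (rho i)) -> (forall i y, 0 <= rho i y) ->
    (forall i y, rho i y * exponential_density (mu i) (s i) y =
       exponential_density (mu' i) (s' i) y) ->
    measurable_fun setT F -> (forall x, 0 <= F x) ->
  (\int[law mu' s']_x (F x)%:E =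
   \int[law mu s]_x (F x * \prod_i \prod_(j < n i) rho i (x i j))%:E)%E.
Proof.
move=> s0 s'0 mrho rho0 rhoE mF F0.
rewrite (change_of_law hP (mu := mu) (s := s) (phi := fun _ => id) (rho := rho))//.
by move=> i j B mB; exact: reweighted_observation.
Qed.

Lemma measurable_lt_Xmin i a : measurable [set x : S | a < Xmin i x].
Proof.
have := @measurable_Xmin R k n i measurableT _ (measurable_itv `]a, +oo[).
rewrite setTI; congr (measurable _).
by apply/seteqP; split=> x /=; rewrite in_itv/= andbT.
Qed.

Definition spacings x : 'I_k -> R := fun i => T i x.

Let exponential_law i (b : R) : {measure set R -> \bar R} :=
  distribution (P (fun=> 0) (fun=> b)) (X i (Ordinal (n_gt0 i))).

Let exponential_law_tail i (b a : R) : 0 < b ->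
  exponential_law i b `]a, +oo[%classic = (expR (- Num.max 0 (a / b)))%:E.
Proof.
move=> b0; have := tail_observation hP (fun=> 0) (Ordinal (n_gt0 i)) a (s := fun=> b).
by rewrite subr0 => <-.
Qed.

Let exponential_law_laplace i (b c : R) : 0 < b -> 0 < 1 + c * b ->
  (\int[exponential_law i b]_z (expR (- (c * z)))%:E = (1 + c * b)^-1%:E)%E.
Proof.
move=> b0 cb0.
have b'0 : 0 < b / (1 + c * b) by rewrite divr_gt0.
have mexp : measurable_fun setT (fun z : R => expR (- (c * z))).
  apply: measurableT_comp => //.
  by apply: measurable_funN; exact: measurable_funM.
rewrite ge0_integral_distribution//; last exact/measurable_EFinP.
have := @reweighted_observation _ _ _ _ _ _ _ hP (fun=> 0) (fun=> 0) (fun=> b)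
  (fun=> b / (1 + c * b)) (fun z => (1 + c * b) * expR (- (c * z)))
  i (Ordinal (n_gt0 i)) setT (fun=> b0) (fun=> b'0).
rewrite preimage_setT probability_setT => E.
transitivity ((1 + c * b)^-1%:E * \int[P (fun=> 0%R) (fun=> b)]_w (\1_setT (X i (Ordinal (n_gt0 i)) w) *
  ((1 + c * b) * expR (- (c * X i (Ordinal (n_gt0 i)) w))))%:E)%E.
  rewrite -ge0_integralZl//.
  - apply: eq_integral => w _; rewrite indicE in_setT mul1r -EFinM mulrA mulVf ?mul1r//.
    by rewrite gt_eqF.
  - apply/measurable_EFinP; apply: measurable_funM.
      exact: (measurableT_comp (measurable_indic _)).
    apply: measurable_funM => //.
    exact: (measurableT_comp mexp (measurable_funPT (X i (Ordinal (n_gt0 i))))).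
  - by move=> w _; rewrite lee_fin indicE mulr_ge0// mulr_ge0 ?expR_ge0// ltW.
  - by rewrite lee_fin invr_ge0 ltW.
rewrite E ?mule1//.
- exact: measurable_funM.
- by move=> z; rewrite mulr_ge0 ?expR_ge0 ?ltW.
- move=> z; rewrite /exponential_density; case: ifP => _; rewrite ?mulr0//.
  have bn0 : b != 0 by rewrite gt_eqF.
  have cn0 : 1 + c * b != 0 by rewrite gt_eqF.
  rewrite subr0 mulrACA -expRD; congr (_ * expR _); first by field; rewrite bn0 cn0.
  by field; rewrite bn0 cn0.
Qed.

Section functions_of_spacings.
Variable H : ('I_k -> R) -> R.
Hypotheses (mH : measurable_fun setT (H \o spacings : S -> R))
           (H0 : forall t, 0 <= H t).

Lemma law_scale mu mu' s lam : positive_scales s -> positive_scales lam ->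
  (\int[law mu' (fun i => lam i * s i)%R]_x (H (spacings x))%:E =
   \int[law mu s]_x (H (fun i => (lam i * spacings x i)%R))%:E)%E.
Proof.
move=> s0 l0; rewrite (@affine_law mu mu' s lam (H \o spacings))//; last by move=> x; exact: H0.
apply: eq_integral => x _ /=; congr (H _)%:E; apply/funext => i.
by rewrite /spacings T_affine// l0.
Qed.

Lemma law_location mu mu' s : positive_scales s ->
  (\int[law mu' s]_x (H (spacings x))%:E = \int[law mu s]_x (H (spacings x))%:E)%E.
Proof.
move=> s0; have := law_scale mu mu' s0 (lam := fun=> 1) (fun=> ltr01).
rewrite (_ : (fun i => 1 * s i) = s); last by apply/funext => i; rewrite mul1r.
move=> ->; apply: eq_integral => x _; congr (H _)%:E.
by apply/funext => i; rewrite mul1r.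
Qed.

(** Conditioning the observations of population i to exceed [mu i + a] amounts
    to raising their location by a, which functions of the spacings do not
    see. *)
Lemma law_Xmin_tail mu s i a : positive_scales s -> 0 <= a ->
  (\int[law mu s]_x (H (spacings x) * \1_[set x | mu i + a < Xmin i x] x)%:E =
   (expR (- (a / (s i / (n i)%:R))))%:E * \int[law mu s]_x (H (spacings x))%:E)%E.
Proof.
move=> s0 a0; pose mu' l := if l == i then mu i + a else mu l.
pose rho l y := if l == i then (if mu i + a < y then expR (a / s i) else 0) else 1.
have mrho l : measurable_fun setT (rho l).
  rewrite /rho; have [_|_] := eqVneq l i; last exact: measurable_cst.
  by apply: measurable_fun_ifT => //; exact: measurable_fun_ltr.
have rho0 l y : 0 <= rho l y.
  by rewrite /rho; do 2 case: ifP => // _; exact: expR_ge0.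
rewrite -(law_location mu mu' s0) (@reweighted_law mu mu' s s rho (H \o spacings))//; last 2 first.
- move=> l y; rewrite /rho /mu'; case: eqP => [->|_]; last by rewrite mul1r.
  rewrite /exponential_density; case: (ltP (mu i + a)) => ay; last by rewrite mul0r.
  rewrite (le_lt_trans _ ay) ?lerDl// mulrCA -expRD; congr (_ * expR _).
  by field; rewrite gt_eqF.
- by move=> x; exact: H0.
have n0 : 0 < (n i)%:R :> R by rewrite ltr0n.
rewrite -ge0_integralZl//; last 2 first.
- apply/measurable_EFinP; apply: measurable_funM => //.
  apply: measurable_prod => l _; apply: measurable_prod => j _.
  by apply: (measurableT_comp (mrho l)); exact: measurable_coordinate.
- move=> x _; rewrite lee_fin; apply: mulr_ge0; first exact: H0.
  by apply: prodr_ge0 => l _; apply: prodr_ge0 => j _; exact: rho0.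
apply: eq_integral => x _; rewrite -EFinM mulrCA; congr (_ * _)%:E.
rewrite (bigD1 i)//= [X in _ * (_ * X)]big1 ?mulr1; last first.
  by move=> l li; apply: big1 => j _; rewrite /rho (negPf li).
rewrite indicE; have [xa|xa] := boolP (x \in _).
  rewrite (eq_bigr (fun=> expR (a / s i))).
    rewrite prodr_const card_ord -expRM_natl -expRD -[1%:R]expR0; congr expR.
    by field; rewrite !gt_eqF.
  move=> j _; rewrite /rho eqxx.
  by move: xa; rewrite inE/= lt_Xmin// => /forallP ->.
have : ~~ (mu i + a < Xmin i x) by apply: contra xa; rewrite inE.
rewrite lt_Xmin// negb_forall => /existsP[j /negPf xj].
by rewrite (bigD1 j)//= /rho eqxx xj mul0r mulr0.
Qed.

(** Hence the excess of the minimum over the location is independent of the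
    spacings and exponential with scale [s i / n i]. *)
Lemma law_Xmin_laplace_finite mu s i c : positive_scales s ->
    0 < 1 + c * (s i / (n i)%:R) ->
    (\int[law mu s]_x (H (spacings x))%:E < +oo)%E ->
  (\int[law mu s]_x (H (spacings x) * expR (- (c * (Xmin i x - mu i))))%:E =
   ((1 + c * (s i / (n i)%:R))^-1)%:E * \int[law mu s]_x (H (spacings x))%:E)%E.
Proof.
move=> s0 cs0 Hoo.
have sn0 : 0 < s i / (n i)%:R by rewrite divr_gt0// ltr0n.
pose Z x := Xmin i x - mu i.
have mZ : measurable_fun setT Z by apply: measurable_funB => //; exact: measurable_Xmin.
set e := (\int[law mu s]_x _)%E in Hoo *.
have e0 : (0 <= e)%E by apply: integral_ge0 => x _; rewrite lee_fin.
have efin : e \is a fin_num by rewrite ge0_fin_numE.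
have fe0 : 0 <= fine e by exact: fine_ge0.
have H0' x : 0 <= (H \o spacings) x by exact: H0.
pose m1 := pushforward (weighted (law mu s) mH H0') Z.
pose m2 := mscale (NngNum fe0) (exponential_law i (s i / (n i)%:R)).
pose tail a := (\int[law mu s]_x (H (spacings x) * \1_[set x | mu i + a < Xmin i x] x)%:E)%E.
have m1E a : m1 `]a, +oo[%classic = tail a.
  rewrite /m1/= /pushforward /weighted /tail [LHS]integral_mkcond.
  apply: eq_integral => x _; rewrite patchE indicE.
  have -> : (x \in Z @^-1` `]a, +oo[) = (x \in [set x | mu i + a < Xmin i x]).
    by apply/idP/idP; rewrite !inE/= in_itv/= andbT /Z ltrBrDl.
  by case: ifP => _; rewrite ?mulr1 ?mulr0.
have tail_le a b : a <= b -> (tail b <= tail a)%E.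
  move=> ab; apply: ge0_le_integral => //.
  - by move=> x _; rewrite lee_fin mulr_ge0.
  - apply/measurable_EFinP; apply: measurable_funM => //.
    by apply: measurable_indic; exact: measurable_lt_Xmin.
  - apply/measurable_EFinP; apply: measurable_funM => //.
    by apply: measurable_indic; exact: measurable_lt_Xmin.
  - move=> x _; rewrite lee_fin ler_wpM2l// !indicE ler_nat.
    have [xb|//] := boolP (x \in [set x | mu i + b < Xmin i x]).
    rewrite mem_set//=; move: xb; rewrite inE/=; apply: le_lt_trans.
    by rewrite lerD2l.
have tail_le_e a : (tail a <= e)%E.
  apply: ge0_le_integral => //.
  - by move=> x _; rewrite lee_fin mulr_ge0.
  - apply/measurable_EFinP; apply: measurable_funM => //.
    by apply: measurable_indic; exact: measurable_lt_Xmin.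
  - exact/measurable_EFinP.
  - by move=> x _; rewrite lee_fin ler_piMr// indicE lern1 leq_b1.
have tailE a : 0 <= a -> tail a = ((expR (- (a / (s i / (n i)%:R))))%:E * e)%E.
  exact: law_Xmin_tail.
have /(_ mZ) m12 : forall (m : measurable_fun setT Z) A, measurable A -> m1 A = m2 A.
  move=> m; apply: measure_eq_rays => a.
    change (m1 `]a, +oo[%classic =
      ((fine e)%:E * exponential_law i (s i / (n i)%:R) `]a, +oo[%classic)%E).
    rewrite m1E exponential_law_tail// fineK//.
    have [a0|a0] := leP 0 a; first by rewrite tailE// max_r 1?muleC// divr_ge0// ltW.
    rewrite max_l ?oppr0 ?expR0 ?mule1; last first.
      by apply: mulr_le0_ge0; rewrite ?invr_ge0; exact: ltW.
    apply/eqP; rewrite eq_le tail_le_e/= (le_trans _ (tail_le _ _ (ltW a0)))//.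
    by rewrite tailE// mul0r oppr0 expR0 mul1e.
  change (m1 `]a, +oo[%classic < +oo)%E.
  by rewrite m1E (le_lt_trans (tail_le_e a)).
have mexp : measurable_fun setT (fun z : R => expR (- (c * z))).
  apply: measurableT_comp => //.
  by apply: measurable_funN; exact: measurable_funM.
transitivity (\int[m1]_z (expR (- (c * z)))%:E)%E.
  rewrite [RHS]ge0_integral_pushforward//=; last exact/measurable_EFinP.
  rewrite preimage_setT.
  rewrite [RHS](@ge0_integral_density _ _ _ (law mu s) _ mH H0' (weighted (law mu s) mH H0'))//=.
  - by apply: eq_integral => x _; rewrite -EFinM mulrC.
  - by apply/measurable_EFinP; exact: (measurableT_comp mexp mZ).
rewrite (eq_measure_integral m2)/=; last by move=> A mA _; exact: m12.
rewrite ge0_integral_mscale//=; last exact/measurable_EFinP.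
by rewrite fineK// exponential_law_laplace// muleC.
Qed.

End functions_of_spacings.

Definition spacing_measurable H :=
  measurable_fun setT (H \o spacings : S -> R).

Lemma law_Xmin_laplace H mu s i c :
    spacing_measurable H -> (forall t, 0 <= H t) -> positive_scales s ->
    0 < 1 + c * (s i / (n i)%:R) ->
  (\int[law mu s]_x (H (spacings x) * expR (- (c * (Xmin i x - mu i))))%:E =
   ((1 + c * (s i / (n i)%:R))^-1)%:E * \int[law mu s]_x (H (spacings x))%:E)%E.
Proof.
move=> mH H0 s0 cs0.
have mexp : measurable_fun setT (fun x : S => expR (- (c * (Xmin i x - mu i)))).
  apply: measurableT_comp => //; apply: measurable_funN.
  by apply: measurable_funM => //; apply: measurable_funB => //; exact: measurable_Xmin.
pose HN (N : nat) t := Num.min (H t) N%:R.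
have mHN N : spacing_measurable (HN N) by exact: measurable_minr.
have HN0 N t : 0 <= HN N t by rewrite le_min H0/=.
rewrite (@integral_truncation _ _ _ (law mu s) (H \o spacings))//; last first.
  by move=> x; exact: H0.
have -> : (\int[law mu s]_x (H (spacings x))%:E =
    limn (fun N => \int[law mu s]_x (HN N (spacings x))%:E))%E.
  under eq_integral do rewrite -[H _]mulr1.
  rewrite (@integral_truncation _ _ _ (law mu s) (H \o spacings) (fun=> 1))//; last first.
    by move=> x; exact: H0.
  by congr (limn _); apply/funext => N; under eq_integral do rewrite mulr1.
rewrite -limeMl//; last first.
  apply: ereal_nondecreasing_is_cvgn => N M NM; apply: ge0_le_integral => //.
  - by move=> x _; rewrite lee_fin.
  - by apply/measurable_EFinP; exact: mHN.
  - by apply/measurable_EFinP; exact: mHN.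
  - move=> x _; rewrite lee_fin /HN le_min !ge_min lexx/= ler_nat NM orbT//.
congr (limn _); apply/funext => N.
rewrite (law_Xmin_laplace_finite (mHN N) (HN0 N))//.
apply: (@le_lt_trans _ _ (\int[law mu s]_x (cst N%:R%:E) x)%E).
  apply: ge0_le_integral => //.
  - by move=> x _; rewrite lee_fin.
  - by apply/measurable_EFinP; exact: mHN.
  - by move=> x _; rewrite lee_fin ge_min lexx orbT.
by rewrite integral_cst// ltey_eq fin_numM// fin_num_measure.
Qed.

End spacings.

(** * Exponential tilting of the spacings *)

Section tilting.
Context (R : realType) (k : nat) (n : 'I_k -> nat).
Hypothesis n_gt0 : forall i, (0 < n i)%N.
Context (d : measure_display) (Omega : measurableType d).
Context (X : forall i : 'I_k, 'I_(n i) -> {mfun Omega >-> R}).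
Arguments X : clear implicits.
Context (P : ('I_k -> R) -> ('I_k -> R) -> probability Omega R).
Hypothesis hP : exponential_model X P.

Local Notation law := (law X P).
Local Notation S := (sample_space R n).
Implicit Types (mu s : 'I_k -> R) (x : S) (H : ('I_k -> R) -> R).

Lemma spacing_measurable_tilt H (f : ('I_k -> R) -> R) :
    spacing_measurable n H -> spacing_measurable n f ->
  spacing_measurable n (fun t => H t * expR (- f t)).
Proof.
move=> mH mf; apply: (measurable_funM mH).
by apply: measurableT_comp => //; exact: measurable_funN.
Qed.

Lemma spacing_measurable_coord i : spacing_measurable n (fun t => t i : R).
Proof. exact: measurable_T. Qed.

(** The likelihood ratio of a change of scale in population i is exponential in
    [\sum_j (x i j - mu i) = T i + n i (Xmin i - mu i)]; integrating the minimum out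
    takes one factor [1 + th * s i] away, whence the exponent [(n i).-1]. *)
Lemma law_tilt1 H mu s i th :
    spacing_measurable n H -> (forall t, 0 <= H t) -> positive_scales s ->
    0 < 1 + th * s i ->
  (\int[law mu (fun l => if l == i then (s i / (1 + th * s i))%R else s l)]_x
     (H (spacings x))%:E =
   ((1 + th * s i) ^+ (n i).-1)%:E *
   \int[law mu s]_x (H (spacings x) * expR (- (th * T i x)))%:E)%E.
Proof.
move=> mH H0 s0 ths0.
set s' := fun l => if _ then _ else _.
have s'0 : positive_scales s'.
  by move=> l; rewrite /s'; case: eqP => _; [exact: divr_gt0|exact: s0].
pose rho l y := if l == i then (1 + th * s i) * expR (- (th * (y - mu i))) else 1.
have n0 : (n i)%:R != 0 :> R by rewrite pnatr_eq0 -lt0n.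
have mrho l : measurable_fun setT (rho l).
  rewrite /rho; have [_|_] := eqVneq l i; last exact: measurable_cst.
  apply: measurable_funM => //; apply: measurableT_comp => //.
  apply: measurable_funN; apply: measurable_funM => //; exact: measurable_funB.
have rho0 l y : 0 <= rho l y.
  by rewrite /rho; case: ifP => // _; rewrite mulr_ge0 ?expR_ge0// ltW.
rewrite (@reweighted_law _ _ _ _ _ _ _ hP mu mu s s' rho (H \o @spacings R k n))//; last 2 first.
- move=> l y; rewrite /rho /s'; case: eqP => [->|_]; last by rewrite mul1r.
  rewrite /exponential_density; case: ifP => _; last by rewrite mulr0.
  rewrite mulrACA -expRD; congr (_ * expR _); field; rewrite !gt_eqF//; exact: s0.
- by move=> x; exact: H0.
pose H' t := H t * expR (- (th * t i)).
have mH' : spacing_measurable n H'.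
  apply: spacing_measurable_tilt => //; apply: measurable_funM => //.
  exact: spacing_measurable_coord.
have H'0 t : 0 <= H' t by rewrite mulr_ge0 ?expR_ge0.
have thn : 1 + th * (n i)%:R * (s i / (n i)%:R) = 1 + th * s i by field.
transitivity (((1 + th * s i) ^+ n i)%:E * \int[law mu s]_x
    (H' (spacings x) * expR (- (th * (n i)%:R * (Xmin i x - mu i))))%:E)%E.
  rewrite -ge0_integralZl//; last 3 first.
  - apply/measurable_EFinP; apply: (measurable_funM mH').
    apply: measurableT_comp => //; apply: measurable_funN.
    by apply: measurable_funM => //; apply: measurable_funB => //; exact: measurable_Xmin.
  - by move=> x _; rewrite lee_fin mulr_ge0 ?expR_ge0.
  - by rewrite lee_fin exprn_ge0// ltW.
  apply: eq_integral => x _; rewrite -EFinM; congr EFin.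
  rewrite (bigD1 i)//= [X in _ * (_ * X)]big1 ?mulr1; last first.
    by move=> l li; apply: big1 => j _; rewrite /rho (negPf li).
  under eq_bigr do rewrite /rho eqxx.
  rewrite big_split/= prodr_const card_ord -expR_sum sumrN -mulr_sumr sum_observations.
  rewrite mulrCA /H' -[in RHS]mulrA -expRD; congr (_ * (_ * expR _)).
  by rewrite /spacings; ring.
rewrite (law_Xmin_laplace n_gt0 hP)//; last by rewrite thn.
rewrite thn muleA -EFinM; congr (_%:E * _)%E.
by rewrite -[in LHS](prednK (n_gt0 i)) exprSr mulfK// gt_eqF.
Qed.

(** The law of the spacings is that of independent Gamma variables of shapes
    [(n i).-1] and scales [s i]; here this is expressed by how the law changes with
    the scales. *)
Lemma law_tilt H mu s th :
    spacing_measurable n H -> (forall t, 0 <= H t) -> positive_scales s ->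
    (forall i, 0 < 1 + th i * s i) ->
  (\int[law mu (fun i => (s i / (1 + th i * s i))%R)]_x (H (spacings x))%:E =
   (\prod_i (1 + th i * s i) ^+ (n i).-1)%:E *
   \int[law mu s]_x (H (spacings x) * expR (- (\sum_i th i * T i x)))%:E)%E.
Proof.
move=> mH H0 s0 ths0.
suff E (r : seq 'I_k) : uniq r -> forall H, spacing_measurable n H ->
    (forall t, 0 <= H t) ->
    (\int[law mu (fun i => if i \in r then (s i / (1 + th i * s i))%R else s i)]_x
       (H (spacings x))%:E =
     (\prod_(i <- r) (1 + th i * s i) ^+ (n i).-1)%:E *
     \int[law mu s]_x (H (spacings x) * expR (- (\sum_(i <- r) th i * T i x)))%:E)%E.
  rewrite -[X in law mu X](_ : (fun i => if i \in index_enum 'I_k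
    then s i / (1 + th i * s i) else s i) = _); last first.
    by apply/funext => i; rewrite mem_index_enum.
  by apply: E => //; exact: index_enum_uniq.
elim: r => [_ {}H {}mH {}H0|a r IH]; last first.
  rewrite cons_uniq => /andP[ar ur] {}H {}mH {}H0.
  set sr := fun i => if i \in r then s i / (1 + th i * s i) else s i.
  have sr0 : positive_scales sr.
    by move=> i; rewrite /sr; case: ifP => _; [exact: divr_gt0|exact: s0].
  have sra : sr a = s a by rewrite /sr (negPf ar).
  have -> : (fun i => if i \in a :: r then s i / (1 + th i * s i) else s i) =
      (fun l => if l == a then sr a / (1 + th a * sr a) else sr l).
    by apply/funext => l; rewrite inE; case: eqP => [->|//]; rewrite sra.
  rewrite law_tilt1// ?sra//.
  pose H' t := H t * expR (- (th a * t a)).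
  rewrite (IH ur H'); last 2 first.
  - apply: spacing_measurable_tilt => //; apply: measurable_funM => //.
    exact: spacing_measurable_coord.
  - by move=> t; rewrite mulr_ge0 ?expR_ge0.
  rewrite muleA -EFinM big_cons; congr (_ * _)%E.
  apply: eq_integral => x _; congr EFin; rewrite /H' big_cons -mulrA -expRD.
  by congr (_ * expR _); rewrite opprD.
rewrite big_nil mul1e; apply: eq_integral => x _.
by rewrite big_nil oppr0 expR0 mulr1.
Qed.

(** The tilt of the constant 1. *)
Lemma laplace_spacings mu s th : positive_scales s ->
    (forall i, 0 < 1 + th i * s i) ->
  ((\prod_i (1 + th i * s i) ^+ (n i).-1)%:E *
   \int[law mu s]_x (expR (- (\sum_i th i * T i x)))%:E = 1)%E.
Proof.
move=> s0 ths0.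
have mass s' : (\int[law mu s']_x 1%:E = 1 :> \bar R)%E.
  by rewrite integral_cst// mul1e; exact: probability_setT.
rewrite -[RHS](mass (fun i => s i / (1 + th i * s i))).
rewrite (@law_tilt (fun=> 1))//; last exact: measurable_cst.
by congr (_ * _)%E; apply: eq_integral => x _; rewrite mul1r.
Qed.

(** If G is homogeneous of degree 1 in the spacings of the populations of J, then
    tilting by [U = \sum_(i in J) T i / s i] rescales these spacings, so that
    under the law weighted by G the variable U has the Laplace transform of a
    Gamma variable of shape [M + 1]. *)
Lemma laplace_homogeneous (J : {pred 'I_k}) G mu s (r : R) :
    spacing_measurable n G -> (forall t, 0 <= G t) ->
    (forall lam t, 0 < lam ->
      G (fun i => (if i \in J then lam else 1) * t i) = lam * G t) ->
    positive_scales s -> 0 < 1 + r ->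
  (((1 + r) ^+ (\sum_(i in J) (n i).-1).+1)%:E *
   \int[law mu s]_x (G (spacings x) * expR (- (r * \sum_(i in J) T i x / s i)))%:E =
   \int[law mu s]_x (G (spacings x))%:E)%E.
Proof.
move=> mG G0 GZ s0 r0.
pose th i := if i \in J then r / s i else 0.
have thE i : 1 + th i * s i = if i \in J then 1 + r else 1.
  by rewrite /th; case: ifP => _; rewrite ?mul0r ?addr0// divfK// gt_eqF ?s0.
have th0 i : 0 < 1 + th i * s i by rewrite thE; case: ifP.
pose lam i := if i \in J then (1 + r)^-1 else 1.
have lam0 : positive_scales lam by move=> i; rewrite /lam; case: ifP; rewrite ?invr_gt0.
have := law_tilt mu mG G0 s0 th0.
rewrite [X in law mu X](_ : _ = fun i => lam i * s i); last first.
  by apply/funext => i; rewrite thE /lam mulrC; case: ifP => _; rewrite ?invr1.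
rewrite (law_scale n_gt0 hP mG G0 mu mu s0 lam0).
have -> : (\int[law mu s]_x (G (fun i => (lam i * spacings x i)%R))%:E =
    (1 + r)^-1%:E * \int[law mu s]_x (G (spacings x))%:E)%E.
  rewrite -ge0_integralZl//; last 3 first.
  - exact/measurable_EFinP.
  - by move=> x _; rewrite lee_fin.
  - by rewrite lee_fin invr_ge0 ltW.
  by apply: eq_integral => x _; rewrite -EFinM -GZ// invr_gt0.
have -> : \prod_i (1 + th i * s i) ^+ (n i).-1 = (1 + r) ^+ (\sum_(i in J) (n i).-1).
  under eq_bigr do rewrite thE.
  rewrite -prodrXr [RHS]big_mkcond; apply: eq_bigr => i _.
  by case: ifP => // _; rewrite expr1n.
have -> : (\int[law mu s]_x (G (spacings x) * expR (- (\sum_i th i * T i x)))%:E =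
    \int[law mu s]_x (G (spacings x) * expR (- (r * \sum_(i in J) T i x / s i)))%:E)%E.
  apply: eq_integral => x _; congr (_ * expR (- _))%:E.
  rewrite mulr_sumr [RHS]big_mkcond; apply: eq_bigr => i _; rewrite /th.
  by case: ifP => _; rewrite ?mul0r// mulrCA mulrC mulrA.
move=> E; rewrite exprS EFinM -muleA -E muleA -EFinM divff ?mul1e// gt_eqF//.
Qed.

End tilting.

(** * Comparison of risks *)

(** The tangent inequality of a strictly convex function; with x and y the
    normalized estimates it reduces to [1 + z <= expR z] at [z = p (x - y)]. *)
Lemma linex_tangent (R : realType) (p sigma a b : R) :
  linex_loss p sigma b + p * (expR (p * (b / sigma - 1)) - 1) * (a / sigma - b / sigma)
    <= linex_loss p sigma a ?= iff ((p == 0) || (a / sigma == b / sigma)).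
Proof.
rewrite /linex_loss; set x := a / sigma; set y := b / sigma.
have -> : expR (p * (x - 1)) = expR (p * (y - 1)) * expR (p * (x - y)).
  by rewrite -expRD; congr expR; ring.
have E0 := expR_gt0 (p * (y - 1)); set E := expR (p * (y - 1)) in E0 *.
have [pxy|pxy] := boolP (_ || _).
  have D0 : p * (x - y) = 0.
    by case/orP: pxy => /eqP ->; rewrite ?mul0r ?subrr ?mulr0.
  by split; last apply/eqP; rewrite ?D0 ?expR0 ?mulr1; nra.
have : 1 + p * (x - y) < expR (p * (x - y)).
  by rewrite expR_gt1Dx// mulf_neq0 ?subr_eq0; move: pxy; rewrite negb_or => /andP[].
move=> H; suff L : expR (p * (y - 1)) - p * (y - 1) - 1 + p * (E - 1) * (x - y)
    < E * expR (p * (x - y)) - p * (x - 1) - 1 by split; [exact: ltW|exact: lt_eqF].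
by rewrite -/E; nra.
Qed.

Lemma linex_loss_ge0 (R : realType) (p sigma a : R) : 0 <= linex_loss p sigma a.
Proof. by rewrite /linex_loss -addrA -opprD subr_ge0 addrC expR_ge1Dx. Qed.

(** Used with the losses of two estimators for f and g and a term derived from the
    tangent inequality for h. *)
Lemma integral_comparison (R : realType) d (T : measurableType d)
    (mu : {measure set T -> \bar R}) (f g h : T -> R) :
    measurable_fun setT f -> measurable_fun setT g ->
    (forall x, 0 <= f x) -> (forall x, 0 <= g x) ->
    mu.-integrable setT (EFin \o h) -> (\int[mu]_x (h x)%:E = 0)%E ->
    (forall x, g x + h x <= f x) ->
    (\int[mu]_x (f x)%:E < +oo)%E \/ (\int[mu]_x (g x)%:E < +oo)%E ->
  ((\int[mu]_x (g x)%:E <= \int[mu]_x (f x)%:E)%E /\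
   (~ {ae mu, forall x, f x = g x + h x} ->
    (\int[mu]_x (g x)%:E < \int[mu]_x (f x)%:E)%E)).
Proof.
move=> mf mg f0 g0 ih h0 ghf fgoo.
have mEf : measurable_fun setT (EFin \o f) by exact/measurable_EFinP.
have mEg : measurable_fun setT (EFin \o g) by exact/measurable_EFinP.
have int_of (u : T -> R) : measurable_fun setT (EFin \o u) -> (forall x, 0 <= u x) ->
    (\int[mu]_x (u x)%:E < +oo)%E -> mu.-integrable setT (EFin \o u).
  move=> mu0 u0 uoo; apply/integrableP; split => //.
  by under eq_integral do rewrite /= ger0_norm//.
have [foo|] := boolP (\int[mu]_x (f x)%:E < +oo)%E; last first.
  rewrite -leNgt leye_eq => /eqP foo; case: fgoo; rewrite foo// => goo.
  by split=> [|_]; rewrite ?leey.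
have if_ := int_of f mEf f0 foo.
have ig : mu.-integrable setT (EFin \o g).
  have ifh : mu.-integrable setT (EFin \o (fun x => f x - h x)).
    by have := integrableB measurableT if_ ih; rewrite /comp; under eq_fun do rewrite -EFinB.
  apply: le_integrable ifh => // x _; rewrite lee_fin ger0_norm// ger0_norm ?lerBrDr//.
  by rewrite add0r (le_trans _ (ghf x))// lerDr.
pose D x := f x - (g x + h x).
have D0 x : 0 <= D x by rewrite subr_ge0.
have igh : mu.-integrable setT (EFin \o (fun x => g x + h x)).
  by have := integrableD measurableT ig ih; rewrite /comp; under eq_fun do rewrite -EFinD.
have iD : (\int[mu]_x (D x)%:E = \int[mu]_x (f x)%:E - \int[mu]_x (g x)%:E)%E.
  rewrite (integralB_EFin measurableT if_ igh).
  by congr (_ - _)%E; rewrite integralD_EFin//= h0 adde0.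
have fing : (\int[mu]_x (g x)%:E)%E \is a fin_num by exact: integrable_fin_num.
have iD0 : (0 <= \int[mu]_x (D x)%:E)%E by apply: integral_ge0 => x _; rewrite lee_fin.
split; first by move: iD0; rewrite iD suber_ge0.
move=> ngh; suff : (0 < \int[mu]_x (D x)%:E)%E by rewrite iD sube_gt0.
rewrite lt_neqAle iD0 andbT eq_sym; apply/eqP => D00; apply: ngh.
have mD : measurable_fun setT (EFin \o D).
  by case/integrableP: (integrableB measurableT if_ igh).
have : (\int[mu]_x `|(D x)%:E| = 0)%E by under eq_integral do rewrite gee0_abs ?lee_fin//.
move/(ae_eq_integral_abs mu measurableT mD).1 => ae0.
apply: filterS ae0 => x /(_ Logic.I) [] /eqP.
by rewrite subr_eq0 => /eqP.
Qed.

(** The optimal multiple of a Gamma variable of shape [m - 1] and scale 1, as an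
    estimator of 1. *)
Definition linex_factor (R : realType) (p : R) (m : nat) : R :=
  p^-1 * (1 - expR (- (p / m%:R))).

Section linex_factor.
Context (R : realType) (p : R).
Hypothesis p0 : p != 0.

Lemma mul_linex_factor m : 1 - p * linex_factor p m = expR (- (p / m%:R)).
Proof. by rewrite /linex_factor mulrA divff// mul1r; ring. Qed.

Lemma linex_factor_decr m m' : (0 < m)%N -> (m < m')%N ->
  linex_factor p m' < linex_factor p m.
Proof.
move=> m0 mm'; have m'0 : (0 < m')%N by exact: ltn_trans mm'.
have V : m'%:R^-1 < m%:R^-1 :> R by rewrite ltf_pV2 ?posrE ?ltr0n// ltr_nat.
rewrite /linex_factor; have [pn|pp|] := ltgtP p 0; last by move=> E; move: p0; rewrite E eqxx.
- by rewrite ltr_nM2l ?invr_lt0// ltrD2l ltrN2 ltr_expR ltrN2 ltr_nM2l.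
- by rewrite ltr_pM2l ?invr_gt0// ltrD2l ltrN2 ltr_expR ltrN2 ltr_pM2l.
Qed.

Lemma linex_factor_gt0 m : (0 < m)%N -> 0 < linex_factor p m.
Proof.
move=> m0; have V : 0 < m%:R^-1 :> R by rewrite invr_gt0 ltr0n.
rewrite /linex_factor; have [pn|pp|] := ltgtP p 0; last by move=> E; move: p0; rewrite E eqxx.
- rewrite nmulr_rgt0 ?invr_lt0// subr_lt0 -[ltLHS]expR0 ltr_expR oppr_gt0.
  by rewrite nmulr_rlt0.
- rewrite pmulr_rgt0 ?invr_gt0// subr_gt0 -[ltRHS]expR0 ltr_expR oppr_lt0.
  by rewrite pmulr_rgt0.
Qed.

End linex_factor.

(** The normalized estimate [b / sigma] lies between u and [a / sigma], so replacing
    the slope of the loss at b by the slope at u weakens the tangent inequality. *)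
Lemma linex_loss_comparison (R : realType) (p sigma a b u : R) :
    p != 0 -> 0 < sigma ->
    [\/ a = b, u <= b / sigma /\ b <= a | b / sigma <= u /\ a <= b] ->
  linex_loss p sigma b + p * (expR (p * (u - 1)) - 1) * ((a - b) / sigma)
    <= linex_loss p sigma a ?= iff (a == b).
Proof.
move=> p0 sigma0 [->|H|H].
- by rewrite subrr mul0r mulr0 addr0 eqxx; split; rewrite ?lexx ?eqxx.
all: have ab : (a / sigma == b / sigma) = (a == b) by
  rewrite -subr_eq0 -mulrBl mulf_eq0 invr_eq0 (gt_eqF sigma0) orbF subr_eq0.
all: have := linex_tangent p sigma a b; rewrite (negPf p0) ab/= -mulrBl => L.
all: have mono (v w : R) : v <= w -> p * (expR (p * (v - 1)) - 1) <= p * (expR (p * (w - 1)) - 1)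
  by move=> vw; have [pn|pp] := ltP p 0;
    [rewrite ler_nM2l// lerD2r ler_expR ler_nM2l// lerD2r
    |rewrite ler_wpM2l// lerD2r ler_expR ler_wpM2l// lerD2r].
all: suff hle : p * (expR (p * (u - 1)) - 1) * ((a - b) / sigma) <=
    p * (expR (p * (b / sigma - 1)) - 1) * ((a - b) / sigma);
  first (split; [by apply: le_trans L.1; rewrite lerD2l|];
    apply/eqP/eqP => [E|->]; last by rewrite subrr mul0r mulr0 addr0);
  first by apply/eqP; rewrite -L.2 eq_le L.1 -E lerD2l.
- by rewrite ler_wpM2r ?mono ?H.1// divr_ge0 ?subr_ge0 ?H.2// ltW.
- by rewrite ler_wnM2r ?mono ?H.1// mulr_le0_ge0 ?subr_le0 ?H.2// invr_ge0 ltW.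
Qed.

Section risk_comparison.
Context (R : realType) (k : nat) (n : 'I_k -> nat).
Hypothesis n_gt1 : forall i, (1 < n i)%N.
Context (d : measure_display) (Omega : measurableType d).
Context (X : forall i : 'I_k, 'I_(n i) -> {mfun Omega >-> R}).
Arguments X : clear implicits.
Context (P : ('I_k -> R) -> ('I_k -> R) -> probability Omega R).
Hypothesis hP : exponential_model X P.
Context (p : R).
Hypothesis p0 : p != 0.

Local Notation law := (law X P).
Local Notation S := (sample_space R n).
Implicit Types (mu s : 'I_k -> R) (x : S).

Let n_gt0 i : (0 < n i)%N. Proof. exact: ltnW. Qed.

Lemma measurable_linex_loss sigma (f : S -> R) : measurable_fun setT f ->
  measurable_fun setT (fun x => linex_loss p sigma (f x)).
Proof.
move=> mf; apply: measurable_funB => //.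
have mx : measurable_fun setT (fun x : S => p * (f x / sigma - 1)).
  by apply: measurable_funM => //; apply: measurable_funB => //; exact: measurable_funM.
by apply: measurable_funB => //; exact: measurableT_comp.
Qed.

Lemma exp_T_lty mu s i c : positive_scales s -> c * s i < 1 ->
  (\int[law mu s]_x (expR (c * T i x))%:E < +oo)%E.
Proof.
move=> s0 cs1; pose th l := if l == i then - c else 0.
have th0 l : 0 < 1 + th l * s l.
  by rewrite /th; case: eqP => [->|_]; rewrite ?mul0r ?addr0// mulNr subr_gt0.
have := laplace_spacings n_gt0 hP mu s0 th0.
rewrite (_ : (\int[law mu s]_x _)%E = (\int[law mu s]_x (expR (c * T i x))%:E)%E); last first.
  apply: eq_integral => x _; congr (expR _)%:E.
  rewrite (bigD1 i)//= big1 ?addr0; last by move=> l /negPf li; rewrite /th li mul0r.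
  by rewrite /th eqxx mulNr opprK.
move=> E; rewrite ltNge leye_eq; apply/eqP => oo; move: E; rewrite oo gt0_muley//.
by rewrite lte_fin prodr_gt0// => l _; rewrite exprn_gt0.
Qed.

Lemma T_integrable mu s i : positive_scales s ->
  (law mu s).-integrable setT (fun x : S => (T i x)%:E).
Proof.
move=> s0; have mT : measurable_fun setT (fun x : S => (T i x)%:E).
  by apply/measurable_EFinP; exact: measurable_T.
apply/integrableP; split => //.
pose c := (2 * s i)^-1.
have c0 : 0 < c by rewrite invr_gt0 mulr_gt0// s0.
have cs : c * s i < 1.
  by rewrite /c invfM -mulrA mulVf ?gt_eqF ?s0// mulr1 invf_lt1// ltr1n.
apply: (@le_lt_trans _ _ (c^-1%:E * \int[law mu s]_x (expR (c * T i x))%:E)%E); last first.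
  by apply: lte_mul_pinfty => //; [rewrite lee_fin invr_ge0 ltW|exact: exp_T_lty].
have mexp : measurable_fun setT (fun x : S => (expR (c * T i x))%:E).
  apply/measurable_EFinP; apply: measurableT_comp => //.
  by apply: measurable_funM => //; exact: measurable_T.
rewrite -ge0_integralZl//; last by rewrite lee_fin invr_ge0 ltW.
apply: ge0_le_integral => //.
- exact: measurableT_comp.
- by apply: measurable_funeM.
- move=> x _; rewrite lee_fin ger0_norm ?T_ge0// mulrC ler_pdivlMr// mulrC.
  by rewrite (le_trans _ (expR_ge1Dx _))// lerDr.
Qed.

(** If [kappa * T i <= T j] almost surely, then [expR (u * (kappa * T i - T j))] has
    mean at most 1 for all [u >= 0], but it blows up as [u * kappa * s i] tends to
    1. *)
Lemma not_ae_dominated mu s i j kappa : positive_scales s -> i != j -> 0 < kappa ->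
  ~ {ae law mu s, forall x : S, kappa * T i x <= T j x}.
Proof.
move=> s0 ij k0 Hae.
pose q := s j / (kappa * s i).
have ks0 : 0 < kappa * s i by rewrite mulr_gt0// s0.
have q0 : 0 < q by rewrite divr_gt0// s0.
pose b := (1 + q) ^+ (n j).-1.
have b1 : 1 <= b by rewrite exprn_ege1// lerDl ltW.
have b0 : 0 < b by exact: lt_le_trans b1.
(* This eps makes the product of the two factors of the Laplace transform at
   most 1/2. *)
pose eps := (2 * b)^-1.
have eps0 : 0 < eps by rewrite invr_gt0 mulr_gt0.
have eps1 : eps < 1 by rewrite invf_lt1 ?mulr_gt0//; lra.
pose u := (1 - eps) / (kappa * s i).
have u0 : 0 <= u by apply: divr_ge0; rewrite ?subr_ge0; exact: ltW.
pose th l := if l == i then - (u * kappa) else if l == j then u else 0.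
have thi : 1 + th i * s i = eps.
  by rewrite /th eqxx mulNr -mulrA divfK ?gt_eqF//; ring.
have thj : 1 + th j * s j = 1 + (1 - eps) * q.
  by rewrite /th eq_sym (negPf ij) eqxx /u /q mulrAC mulrA.
have th0 l : 0 < 1 + th l * s l.
  have [->|li] := eqVneq l i; first by rewrite thi.
  have [->|lj] := eqVneq l j; last by rewrite /th (negPf li) (negPf lj) mul0r addr0.
  by rewrite thj ltr_pwDl// mulr_ge0 ?subr_ge0// ltW.
have := laplace_spacings n_gt0 hP mu s0 th0.
rewrite (bigD1 i)//= (bigD1 j) 1?eq_sym//= big1 ?mulr1; last first.
  by move=> l /andP[li lj]; rewrite /th (negPf li) (negPf lj) mul0r addr0 expr1n.
rewrite thi thj => E.
have ae1 : (\int[law mu s]_x (expR (- (\sum_l th l * T l x)))%:E <=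
    \int[law mu s]_x (cst 1%E x))%E.
  apply: ae_ge0_le_integral => //.
  - apply/measurable_EFinP; apply: measurableT_comp => //; apply: measurable_funN.
    by apply: measurable_sum => l; apply: measurable_funM => //; exact: measurable_T.
  - apply: filterS Hae => x Hx _; rewrite lee_fin -[leRHS]expR0 ler_expR oppr_le0.
    rewrite (bigD1 i)//= (bigD1 j) 1?eq_sym//= big1 ?addr0; last first.
      by move=> l /andP[li lj]; rewrite /th (negPf li) (negPf lj) mul0r.
    rewrite /th eqxx eq_sym (negPf ij) eqxx mulNr addrC subr_ge0 -mulrA.
    by rewrite ler_wpM2l.
have mass : (\int[law mu s]_x (cst 1%E x) = 1)%E.
  by rewrite integral_cst// mul1e; exact: probability_setT.
rewrite mass in ae1.
have small : eps ^+ (n i).-1 * (1 + (1 - eps) * q) ^+ (n j).-1 <= 2^-1.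
  have -> : 2^-1 = eps * b by rewrite /eps invfM -mulrA mulVf ?mulr1// gt_eqF.
  have thj0 : 0 <= 1 + (1 - eps) * q by rewrite -thj ltW.
  apply: ler_pM; [exact/exprn_ge0/ltW|exact: exprn_ge0| |].
    case m : (n i).-1 => [|m']; first by have := n_gt1 i; rewrite -(prednK (n_gt0 i)) m.
    by rewrite exprS ler_piMr ?exprn_ile1// ltW.
  by apply: lerXn2r; rewrite ?nnegrE//; [rewrite addr_ge0// ltW|rewrite lerD2l; nra].
have : (1 <= (2^-1)%:E * 1 :> \bar R)%E.
  rewrite -[leLHS]E; apply: lee_pmul => //.
  - by rewrite lee_fin mulr_ge0// exprn_ge0// ltW// -thj.
  - by apply: integral_ge0 => x _; rewrite lee_fin.
by rewrite mule1 lee_fin; lra.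
Qed.

Lemma riskE i (delta : sample R n -> R) mu s :
    measurable_fun setT (delta : S -> R) ->
  risk X P p i delta mu s = (\int[law mu s]_x (linex_loss p (s i) (delta x))%:E)%E.
Proof.
move=> mdelta; rewrite /risk unlock ge0_integral_law//.
- by apply/measurable_EFinP; exact: measurable_linex_loss.
- by move=> x; rewrite lee_fin linex_loss_ge0.
Qed.

(** The derivative of the loss has mean zero at the optimal multiple of
    [U = \sum_(i in J) T i / s i], also after weighting by G, because U is independent
    of the ratios of the spacings. *)
Lemma weighted_score (J : {pred 'I_k}) G mu s :
    spacing_measurable n G -> (forall t, 0 <= G t) ->
    (forall lam t, 0 < lam ->
      G (fun i => (if i \in J then lam else 1) * t i) = lam * G t) ->
    positive_scales s ->
    (\int[law mu s]_x (G (spacings x))%:E < +oo)%E ->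
  let u x := linex_factor p (\sum_(i in J) (n i).-1).+1 * \sum_(i in J) T i x / s i in
  let h x := (expR (p * (u x - 1)) - 1) * G (spacings x) in
  (law mu s).-integrable setT (EFin \o h) /\ (\int[law mu s]_x (h x)%:E = 0)%E.
Proof.
move=> mG G0 GZ s0 Goo; set m := (\sum_(i in J) (n i).-1).+1; move=> u h.
pose r := - (p * linex_factor p m).
have rE : 1 + r = expR (- (p / m%:R)) by rewrite -mul_linex_factor.
have r0 : 0 < 1 + r by rewrite rE expR_gt0.
have rm : (1 + r) ^+ m = expR (- p).
  by rewrite rE -expRM_natl; congr expR; field; rewrite pnatr_eq0.
have mU : measurable_fun setT (fun x : S => \sum_(i in J) T i x / s i).
  under eq_fun do rewrite big_mkcond.
  apply: measurable_sum => j; case: (j \in J) => //.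
  by apply: measurable_funM => //; exact: measurable_T.
have mGU : measurable_fun setT
    (fun x : S => (G (spacings x) * expR (- (r * \sum_(i in J) T i x / s i)))%:E).
  apply/measurable_EFinP; apply: (measurable_funM mG); apply: measurableT_comp => //.
  by apply: measurable_funN; exact: measurable_funM.
have := laplace_homogeneous n_gt0 hP mu mG G0 GZ s0 r0; rewrite -/m rm.
rewrite -ge0_integralZl//; last first.
  by move=> x _; rewrite lee_fin mulr_ge0 ?expR_ge0.
pose A x := expR (p * (u x - 1)) * G (spacings x).
rewrite (eq_integral (EFin \o A)); last first.
  move=> x _; rewrite -EFinM mulrCA -expRD mulrC; congr (expR _ * _)%:E.
  by rewrite /u /r; ring.
move=> AG.
have A0 x : 0 <= A x by rewrite mulr_ge0 ?expR_ge0.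
have mA : measurable_fun setT A.
  apply: (measurable_funM _ mG); apply: measurableT_comp => //.
  by apply: measurable_funM => //; apply: measurable_funB => //; exact: measurable_funM.
have iA : (law mu s).-integrable setT (EFin \o A).
  apply/integrableP; split; first exact/measurable_EFinP.
  by under eq_integral do rewrite /= ger0_norm//; rewrite AG.
have iG : (law mu s).-integrable setT (EFin \o (G \o @spacings R k n)).
  apply/integrableP; split; first exact/measurable_EFinP.
  by under eq_integral do rewrite /= ger0_norm//.
have hE : h = (fun x => A x - (G \o @spacings R k n) x).
  by apply/funext => x; rewrite /h /A mulrBl mul1r.
split.
  have := integrableB measurableT iA iG.
  by rewrite hE /comp; under eq_fun do rewrite -EFinB.
rewrite hE; under eq_integral do rewrite EFinB.
rewrite integralB_EFin// AG subee//.
by apply: integrable_fin_num iG.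
Qed.

(** When the difference of two estimators is a multiple of a homogeneous weight G
    and delta' lies between delta and [s i] times the optimal multiple u, the slope
    at u contributes a term of mean zero. *)
Lemma risk_comparison (J : {pred 'I_k}) G (eps : R) i (delta delta' : S -> R) mu s :
    spacing_measurable n G -> (forall t, 0 <= G t) ->
    (forall lam t, 0 < lam ->
      G (fun i => (if i \in J then lam else 1) * t i) = lam * G t) ->
    positive_scales s ->
    (\int[law mu s]_x (G (spacings x))%:E < +oo)%E ->
    measurable_fun setT delta -> measurable_fun setT delta' ->
    (forall x, delta x - delta' x = eps * G (spacings x)) ->
    (forall x, let u := linex_factor p (\sum_(j in J) (n j).-1).+1 *
                        \sum_(j in J) T j x / s j in
      [\/ delta x = delta' x, u <= delta' x / s i /\ delta' x <= delta x |
          delta' x / s i <= u /\ delta x <= delta' x]) ->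
    (risk X P p i delta mu s < +oo)%E \/ (risk X P p i delta' mu s < +oo)%E ->
  (risk X P p i delta' mu s <= risk X P p i delta mu s)%E /\
  (~ {ae law mu s, forall x, delta x = delta' x} ->
   (risk X P p i delta' mu s < risk X P p i delta mu s)%E).
Proof.
move=> mG G0 GZ s0 Goo mdelta mdelta' dG dd' doo.
pose u x := linex_factor p (\sum_(j in J) (n j).-1).+1 * \sum_(j in J) T j x / s j.
pose h x := (expR (p * (u x - 1)) - 1) * G (spacings x).
have [ih h0] : (law mu s).-integrable setT (EFin \o h) /\ (\int[law mu s]_x (h x)%:E = 0)%E.
  exact: weighted_score.
pose c := p * eps / s i.
have ich : (law mu s).-integrable setT (EFin \o (fun x => c * h x)).
  have := integrableZl measurableT c ih.
  by rewrite /comp; under eq_fun do rewrite -EFinM.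
have key x : linex_loss p (s i) (delta' x) + c * h x <= linex_loss p (s i) (delta x)
    ?= iff (delta x == delta' x).
  rewrite (_ : c * h x = p * (expR (p * (u x - 1)) - 1) * ((delta x - delta' x) / s i)).
    by apply: linex_loss_comparison => //; exact: dd'.
  by rewrite dG /c /h; ring.
rewrite !riskE// in doo *.
have [|le lt] := integral_comparison (measurable_linex_loss (s i) mdelta)
  (measurable_linex_loss (s i) mdelta')
  (fun x => linex_loss_ge0 p (s i) (delta x)) (fun x => linex_loss_ge0 p (s i) (delta' x))
  ich _ (fun x => (key x).1) doo.
  under eq_integral do rewrite EFinM.
  by rewrite integralZl// h0 mule0.
split=> // ndd'; apply: lt => ae; apply: ndd'.
by apply: filterS ae => x /eqP; rewrite eq_sym (key x).2 => /eqP.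
Qed.

Lemma risk_equivariant_lty i mu s : positive_scales s ->
  (risk X P p i (equivariant (linex_factor p (n i)) i) mu s < +oo)%E.
Proof.
move=> s0; rewrite riskE; last first.
  by apply: measurable_funM => //; exact: measurable_T.
set e := linex_factor p (n i).
have pe : p * e / s i * s i < 1.
  by rewrite divfK ?gt_eqF// -subr_gt0 mul_linex_factor// expR_gt0.
have iexp : (law mu s).-integrable setT (fun x : S => (expR (p * e / s i * T i x))%:E).
  apply/integrableP; split.
    apply/measurable_EFinP; apply: measurableT_comp => //.
    by apply: measurable_funM => //; exact: measurable_T.
  by under eq_integral do rewrite gee0_abs ?lee_fin ?expR_ge0//; exact: exp_T_lty.
have iT := T_integrable mu i s0.
have i1 : (law mu s).-integrable setT (cst (p - 1)%:E).
  exact: finite_measure_integrable_cst.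
have := integrable_lty measurableT (integrableD measurableT (integrableZl measurableT (expR (- p)) iexp)
  (integrableD measurableT (integrableZl measurableT (- (p * e / s i)) iT) i1)).
congr (_ < _)%E; apply: eq_integral => x _; rewrite /= -!EFinM -!EFinD; congr EFin.
rewrite -expRD /linex_loss /equivariant.
have -> : p * (e * T i x / s i - 1) = - p + p * e / s i * T i x by ring.
by ring.
Qed.

(** The spacings are almost surely positive, as their Laplace transform vanishes
    at infinity. *)
Lemma T_gt0_ae mu s i : positive_scales s -> {ae law mu s, forall x : S, 0 < T i x}.
Proof.
move=> s0; pose A : set S := [set x | T i x <= 0].
have mA : measurable A.
  have := @measurable_T R k n i measurableT _ (measurable_itv `]-oo, 0]).
  by rewrite setTI; congr (measurable _); apply/seteqP; split=> x /=; rewrite in_itv.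
exists A; split => //; last by move=> x /negP; rewrite -leNgt.
apply/eqP; rewrite -[_ == _]negbK; apply/negP => A0.
pose a := fine (law mu s A).
have aE : law mu s A = a%:E by rewrite fineK// fin_num_measure.
have a0 : 0 < a by rewrite -lte_fin -aE lt0e A0 measure_ge0.
pose th l := if l == i then (a * s i)^-1 else 0.
have as0 : 0 < a * s i by rewrite mulr_gt0// s0.
have thi : 1 + th i * s i = 1 + a^-1.
  by rewrite /th eqxx invfM mulfVK// gt_eqF// s0.
have th0 l : 0 < 1 + th l * s l.
  have [->|li] := eqVneq l i; first by rewrite thi addr_gt0// invr_gt0.
  by rewrite /th (negPf li) mul0r addr0.
have := laplace_spacings n_gt0 hP mu s0 th0.
rewrite (bigD1 i)//= big1 ?mulr1; last first.
  by move=> l li; rewrite /th (negPf li) mul0r addr0 expr1n.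
rewrite thi => E.
have : (((1 + a^-1) ^+ (n i).-1)%:E * a%:E <= 1)%E.
  rewrite -E; apply: lee_wpmul2l.
    by rewrite lee_fin exprn_ge0// addr_ge0// invr_ge0 ltW.
  rewrite -aE -(setIT A) -integral_indic//.
  apply: ge0_le_integral => //.
  - exact/measurable_EFinP/measurable_indic.
  - apply/measurable_EFinP; apply: measurableT_comp => //; apply: measurable_funN.
    by apply: measurable_sum => l; apply: measurable_funM => //; exact: measurable_T.
  - move=> x _; rewrite lee_fin indicE; have [|_] := boolP (x \in A); last exact: expR_ge0.
    rewrite inE /A/= => Tx; rewrite -expR0 ler_expR oppr_ge0.
    rewrite (bigD1 i)//= big1 ?addr0; last by move=> l li; rewrite /th (negPf li) mul0r.
    by rewrite /th eqxx mulr_ge0_le0// invr_ge0 ltW.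
rewrite -EFinM lee_fin; apply/negP; rewrite -ltNge.
have a1 : 1 <= 1 + a^-1 by rewrite lerDl invr_ge0 ltW.
apply: (@lt_le_trans _ _ ((1 + a^-1) * a)).
  by rewrite mulrDl mul1r mulVf ?gt_eqF// ltrDr.
apply: ler_wpM2r; first exact: ltW.
case m : (n i).-1 => [|m']; first by have := n_gt1 i; rewrite -(prednK (n_gt0 i)) m.
by rewrite exprS ler_peMr ?exprn_ege1// (le_trans _ a1).
Qed.

Lemma law_not_ae_False mu s : ~ {ae law mu s, forall x : S, False}.
Proof.
move=> [A [mA A0 /(_ _ (fun F => F)) AT]].
have := probability_setT (law mu s); rewrite (_ : setT = A).
  by rewrite A0 => /eqP; rewrite eqe eq_sym oner_eq0.
by apply/seteqP; split=> // x _; exact: AT.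
Qed.

(** The comparison with weight [`|T i|], where the optimal multiple of T i is itself
    one of the two estimators; the strict inequality gives uniqueness. *)
Lemma best_affine_equivariantP i c :
  best_affine_equivariant X P p i c <-> c = linex_factor p (n i).
Proof.
have lt_risk c' mu s : c' != linex_factor p (n i) -> positive_scales s ->
    (risk X P p i (equivariant (linex_factor p (n i)) i) mu s <
     risk X P p i (equivariant c' i) mu s)%E.
  set e := linex_factor p (n i) => c'e s0.
  pose J := pred1 i; pose G (t : 'I_k -> R) := `|t i|.
  have mequiv b : measurable_fun setT (equivariant b i : S -> R).
    by apply: measurable_funM => //; exact: measurable_T.
  have m_i : (\sum_(j in J) (n j).-1).+1 = n i.
    by rewrite big_pred1_eq prednK.
  apply: (@risk_comparison J G (c' - e) i (equivariant c' i) (equivariant e i) mu s _ _ _ s0 _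
    (mequiv c') (mequiv e) _ _ _).2.
  - by apply: measurableT_comp => //; exact: measurable_T.
  - by move=> t; exact: normr_ge0.
  - by move=> lam t l0; rewrite /G inE eqxx normrM gtr0_norm.
  - have /integrableP[_] := T_integrable mu i s0.
    by under eq_integral do rewrite /=.
  - by move=> x; rewrite /G /spacings ger0_norm ?T_ge0// /equivariant mulrBl.
  - move=> x; rewrite /= m_i big_pred1_eq /equivariant -/e mulrA.
    by case: (leP (e * T i x) (c' * T i x)) => [?|/ltW ?]; [apply: Or32|apply: Or33].
  - by right; exact: risk_equivariant_lty.
  - move=> ae0; apply: (@law_not_ae_False mu s).
    apply: filterS2 ae0 (T_gt0_ae mu i s0) => x /eqP.
    rewrite /equivariant -subr_eq0 -mulrBl mulf_eq0 subr_eq0 (negPf c'e)/= => /eqP ->.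
    by rewrite ltxx.
split=> [best|-> c' mu s s0].
  apply/eqP; rewrite -[_ == _]negbK; apply/negP => /lt_risk.
  move/(_ (fun=> 0) (fun=> 1) (fun=> ltr01)); rewrite ltNge.
  by rewrite best// => i'; exact: ltr01.
have [->//|/lt_risk H] := eqVneq c' (linex_factor p (n i)).
exact/ltW/H.
Qed.

End risk_comparison.

(** * The improved estimators *)

Section improved_estimators.
Context (R : realType) (k : nat) (hk : (2 <= k)%N) (n : 'I_k -> nat).
Hypothesis n_gt1 : forall i, (1 < n i)%N.
Context (p : R).
Hypothesis p0 : p != 0.
Local Notation S := (sample_space R n).
Implicit Types (x : S).

Let n_gt0 i : (0 < n i)%N. Proof. exact: ltnW. Qed.
Let i1 := pop1 hk.
Let i2 := pop2 hk.

Let pair : {pred 'I_k} := pred2 i1 i2.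

Lemma sum_pair (A : nmodType) (F : 'I_k -> A) :
  \sum_(j in pair) F j = F i1 + F i2.
Proof.
have i12 : i2 != i1 by [].
rewrite (bigD1 i1)/= ?inE ?eqxx//; congr (_ + _).
apply: big_pred1 => j; rewrite /pair !inE.
by have [->|_] := eqVneq j i1; rewrite ?andbF ?andbT//= eq_sym (negPf i12).
Qed.

Lemma e1E : e1 n p hk = linex_factor p (\sum_(j in pair) (n j).-1).+1.
Proof.
rewrite /e1 /linex_factor sum_pair.
rewrite (_ : (_ + _).+1%:R = (n i1)%:R + (n i2)%:R - 1 :> R)//.
rewrite -[in RHS](prednK (n_gt0 i1)) -[in RHS](prednK (n_gt0 i2)).
by rewrite -!natr1 natrD; ring.
Qed.

Lemma e1_lt_d0 : e1 n p hk < d0 n p i1.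
Proof.
rewrite e1E; apply: linex_factor_decr => //.
by rewrite sum_pair -[ltnLHS](prednK (n_gt0 i1)) ltnS -[ltnLHS]addn0 ltn_add2l -ltnS prednK.
Qed.

Lemma e2E : e2 n p = linex_factor p (\sum_(j in predT) (n j).-1).+1.
Proof.
rewrite /e2 /linex_factor.
suff -> : (\sum_(j in predT) (n j).-1).+1%:R = ((\sum_(j < k) n j)%N)%:R - k%:R + 1 :> R by [].
rewrite -natr1; congr (_ + 1).
rewrite [in RHS](eq_bigr (fun j => (n j).-1 + 1)%N); last by move=> j _; rewrite addn1 prednK.
by rewrite big_split/= sum1_card card_ord natrD addrK.
Qed.

(** The branch [d01 < e1] is empty because the factor decreases with the shape. *)
Lemma improved_firstE x :
  improved_first p hk x = Num.min (d0 n p i1 * T i1 x) (e1 n p hk * (T i1 x + T i2 x)).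
Proof.
have e1_gt0 : 0 < e1 n p hk by rewrite e1E linex_factor_gt0.
have e1_lt := e1_lt_d0.
have := T_ge0 i1 x; have := T_ge0 i2 x.
rewrite /improved_first -/i1 -/i2 /V ltNge (ltW e1_lt)/= => T2.
rewrite le_eqVlt => /orP[/eqP T1|T1].
  rewrite -T1 !mulr0 add0r if_same min_l// mulr_ge0//; exact: ltW.
have -> : e1 n p hk * (T i1 x + T i2 x) = e1 n p hk * (1 + T i2 x / T i1 x) * T i1 x.
  by field; rewrite gt_eqF.
by rewrite /Num.min ltr_pM2r// le_eqVlt; case: eqVneq => [->|_]/=; [rewrite ltxx|case: ifP].
Qed.

(** Where [T i x = 0], the ratios take the value 0 and the estimator vanishes,
    while the maximum need not. *)
Lemma improved_laterE (i : 'I_k) x :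
  improved_later p i x = if 0 < T i x then
    Num.max (d0 n p i * T i x) (e2 n p * (T i x + \sum_(j < k | (j < i)%N) T j x)) else 0.
Proof.
rewrite /improved_later; have [T0|] := ltP 0 (T i x); last first.
  move=> Tn; have -> : T i x = 0 by apply/eqP; rewrite eq_le Tn T_ge0.
  by rewrite !mulr0; case: ifP.
have -> : e2 n p * (T i x + \sum_(j < k | (j < i)%N) T j x)
    = e2 n p * (1 + \sum_(j < k | (j < i)%N) V i j x) * T i x.
  rewrite -mulrA mulrDl mul1r mulr_suml; congr (_ * (_ + _)).
  by apply: eq_bigr => j _; rewrite /V divfK// gt_eqF.
by rewrite /Num.max ltr_pM2r//; case: ifP.
Qed.

Context (d : measure_display) (Omega : measurableType d).
Context (X : forall i : 'I_k, 'I_(n i) -> {mfun Omega >-> R}).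
Arguments X : clear implicits.
Context (P : ('I_k -> R) -> ('I_k -> R) -> probability Omega R).
Hypothesis hP : exponential_model X P.
Local Notation law := (law X P).

Lemma measurable_equivariant c i : measurable_fun setT (equivariant c i : S -> R).
Proof. by apply: measurable_funM => //; exact: measurable_T. Qed.

Lemma measurable_improved_first : measurable_fun setT (improved_first p hk : S -> R).
Proof.
rewrite (_ : improved_first _ _ = (fun x : S =>
    Num.min (d0 n p i1 * T i1 x) (e1 n p hk * (T i1 x + T i2 x)))); last first.
  by apply/funext => x; rewrite improved_firstE.
apply: measurable_minr; first exact: measurable_equivariant.
by apply: measurable_funM => //; apply: measurable_funD; exact: measurable_T.
Qed.

Lemma measurable_spacings_upto (i : 'I_k) : measurable_fun setT
  (fun x : S => T i x + \sum_(j < k | (j < i)%N) T j x).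
Proof.
apply: measurable_funD; first exact: measurable_T.
under eq_fun do rewrite big_mkcond.
by apply: measurable_sum => j; case: (j < i)%N => //; exact: measurable_T.
Qed.

Lemma measurable_improved_later i : measurable_fun setT (improved_later p i : S -> R).
Proof.
rewrite (_ : improved_later _ _ = (fun x : S => if 0 < T i x then
    Num.max (d0 n p i * T i x) (e2 n p * (T i x + \sum_(j < k | (j < i)%N) T j x)) else 0)); last first.
  by apply/funext => x; rewrite improved_laterE.
apply: measurable_fun_ifT => //.
  by apply: measurable_fun_ltr => //; exact: measurable_T.
apply: measurable_maxr; first exact: measurable_equivariant.
by apply: measurable_funM => //; exact: measurable_spacings_upto.
Qed.

(** Since [s i1 <= s i2], the truncation level [e1 (T1 + T2)] lies above [s i1]
    times the optimal multiple of [T1 / s i1 + T2 / s i2], so that truncating moves the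
    estimator towards the optimum. *)
Lemma improved_first_lt_risk mu s : positive_scales s -> ordered_scales s ->
  (risk X P p i1 (improved_first p hk) mu s <
   risk X P p i1 (equivariant (d0 n p i1) i1) mu s)%E.
Proof.
move=> s0 so; have s12 : s i1 <= s i2 by exact: so.
have e1_gt0 : 0 < e1 n p hk by rewrite e1E linex_factor_gt0.
have d0_gt0 : 0 < d0 n p i1 by exact: linex_factor_gt0.
have e1_lt := e1_lt_d0.
pose G (t : 'I_k -> R) := Num.max 0 (d0 n p i1 * t i1 - e1 n p hk * (t i1 + t i2)).
have mG : spacing_measurable n G.
  apply: measurable_maxr => //; apply: measurable_funB.
    exact: measurable_equivariant.
  by apply: measurable_funM => //; apply: measurable_funD; exact: measurable_T.
have G0 t : 0 <= G t by rewrite le_max lexx.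
apply: (@risk_comparison _ _ _ n_gt1 _ _ _ _ hP _ p0 pair G 1 i1 _ _ mu s mG G0 _ s0 _
  (measurable_equivariant _ _) measurable_improved_first _ _ _).2.
- move=> lam t l0; rewrite /G !inE !eqxx orbT/= maxr_pMr ?ltW// mulr0.
  by congr Num.max; ring.
- have /integrable_lty : (law mu s).-integrable setT (fun x : S => ((d0 n p i1)%:E * (T i1 x)%:E)%E).
    by apply: integrableZl => //; exact: T_integrable.
  move=> /(_ measurableT); apply: le_lt_trans; apply: ge0_le_integral => //.
  + by move=> x _; rewrite lee_fin.
  + exact/measurable_EFinP.
  + by apply/measurable_EFinP; exact: measurable_equivariant.
  + move=> x _; rewrite -EFinM lee_fin ge_max; apply/andP; split.
      by apply: mulr_ge0; [exact: ltW|exact: T_ge0].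
    by rewrite gerBl; apply: mulr_ge0; [exact: ltW|rewrite addr_ge0 ?T_ge0].
- move=> x; rewrite mul1r improved_firstE /equivariant /G /spacings.
  case: (leP (d0 n p i1 * T i1 x)) => h; first by rewrite subrr max_l// subr_le0.
  by rewrite max_r// subr_ge0 ltW.
- move=> x; rewrite -e1E sum_pair improved_firstE /equivariant /=.
  case: (leP (d0 n p i1 * T i1 x) (e1 n p hk * (T i1 x + T i2 x))) => h; first exact: Or31.
  apply: Or32; split; last exact: ltW.
  rewrite -mulrA ler_pM2l// mulrDl lerD2l ler_wpM2l ?T_ge0//.
  by rewrite lef_pV2 ?posrE ?s0.
- by left; exact: risk_equivariant_lty.
- pose kappa := d0 n p i1 / e1 n p hk - 1.
  have kappa0 : 0 < kappa by rewrite subr_gt0 ltr_pdivlMr// mul1r.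
  have i12 : i1 != i2 by [].
  move=> ae; apply: (not_ae_dominated n_gt1 hP s0 i12 kappa0 (mu := mu)).
  apply: filterS ae => x; rewrite improved_firstE /equivariant => /esym/min_idPl h.
  rewrite /kappa mulrBl mul1r lerBlDl mulrAC ler_pdivrMr//.
  by rewrite [leRHS]mulrC.
Qed.

Lemma improved_first_dominates :
  dominates X P p i1 (improved_first p hk) (equivariant (d0 n p i1) i1).
Proof.
split.
- by apply: is_estimatorP; exact: measurable_improved_first.
- by move=> mu s s0 so; exact/ltW/improved_first_lt_risk.
- exists (fun=> 1); split=> [i|i j _ //|mu]; first exact: ltr01.
  by apply: improved_first_lt_risk => // i; exact: ltr01.
Qed.

(** Since [s j <= s i] for [j < i], the level [e2 (T i + \sum_(j < i) T j)] lies
    below [s i] times the optimal multiple of [\sum_j T j / s j]. *)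
Lemma improved_later_lt_risk (i : 'I_k) mu s : (1 <= i)%N ->
    positive_scales s -> ordered_scales s ->
  (risk X P p i (improved_later p i) mu s <
   risk X P p i (equivariant (d0 n p i) i) mu s)%E.
Proof.
move=> i_ge1 s0 so.
have e2_gt0 : 0 < e2 n p by rewrite e2E linex_factor_gt0.
have d0_gt0 : 0 < d0 n p i by exact: linex_factor_gt0.
pose G (t : 'I_k -> R) := if 0 < t i then
  Num.max 0 (e2 n p * (t i + \sum_(j < k | (j < i)%N) t j) - d0 n p i * t i) else 0.
have mG : spacing_measurable n G.
  apply: measurable_fun_ifT => //.
  by apply: measurable_fun_ltr => //; exact: measurable_T.
  apply: measurable_maxr => //; apply: measurable_funB.
    by apply: measurable_funM => //; exact: measurable_spacings_upto.
  exact: measurable_equivariant.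
have G0 t : 0 <= G t by rewrite /G; case: ifP => // _; rewrite le_max lexx.
apply: (@risk_comparison _ _ _ n_gt1 _ _ _ _ hP _ p0 predT G (-1) i _ _ mu s mG G0 _ s0 _
  (measurable_equivariant _ _) (measurable_improved_later i) _ _ _).2.
- move=> lam t l0; rewrite /G/= pmulr_rgt0//; case: ifP => _; last by rewrite mulr0.
  by rewrite maxr_pMr ?ltW// mulr0 -mulr_sumr; congr Num.max; ring.
- have /integrable_lty : (law mu s).-integrable setT (fun x : S =>
      ((e2 n p)%:E * \sum_(l < k) (T l x)%:E)%E).
    apply: integrableZl => //; apply: integrable_sum => // l _; exact: T_integrable.
  move=> /(_ measurableT); apply: le_lt_trans; apply: ge0_le_integral => //.
  + by move=> x _; rewrite lee_fin.
  + exact/measurable_EFinP.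
  + apply: measurable_funeM; apply: emeasurable_sum => l.
    by apply/measurable_EFinP; exact: measurable_T.
  + move=> x _; rewrite sumEFin -EFinM lee_fin /G.
    have all0 : 0 <= e2 n p * \sum_(l < k) T l x.
      by apply: mulr_ge0; [exact: ltW|apply: sumr_ge0 => l _; exact: T_ge0].
    case: ifP => _ //; rewrite ge_max all0/= lerBlDr -[leLHS]addr0.
    apply: lerD; last by apply: mulr_ge0; [exact: ltW|exact: T_ge0].
    rewrite ler_pM2l// [leRHS](bigD1 i)//= lerD2l big_mkcond [leRHS]big_mkcond/=.
    apply: ler_sum => l _; have [li|_] := ltnP l i; last by case: ifP => // _; exact: T_ge0.
    by rewrite ifT// -val_eqE ltn_eqF.
- move=> x; rewrite improved_laterE /equivariant /G /spacings.
  case: (ltP 0 (T i x)) => T0; last first.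
    by rewrite mulr0 subr0 (_ : T i x = 0) ?mulr0//; apply/eqP; rewrite eq_le T0 T_ge0.
  rewrite /Num.max subr_gt0; case: ltP => h; last by rewrite mulr0 subrr.
  by rewrite mulN1r opprB.
- move=> x; rewrite -e2E improved_laterE /equivariant /=.
  case: (ltP 0 (T i x)) => T0; last first.
    by apply: Or31; rewrite (_ : T i x = 0) ?mulr0//; apply/eqP; rewrite eq_le T0 T_ge0.
  case: (leP (d0 n p i * T i x)
    (e2 n p * (T i x + \sum_(j < k | (j < i)%N) T j x))) => h; last exact: Or31.
  apply: Or33; split=> //.
  rewrite -mulrA ler_pM2l// [leRHS](bigD1 i)//= mulrDl lerD2l mulr_suml.
  rewrite [leLHS]big_mkcond [leRHS]big_mkcond/=; apply: ler_sum => j _.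
  have [ji|ij] := ltnP j i; last by case: ifP => // _; rewrite divr_ge0 ?T_ge0// ltW ?s0.
  have -> : j != i by rewrite -val_eqE ltn_eqF.
  by rewrite ler_wpM2l ?T_ge0// lef_pV2 ?posrE ?s0//; exact/so/ltnW.
- by left; exact: risk_equivariant_lty.
- pose kappa := e2 n p / d0 n p i.
  have kappa0 : 0 < kappa by rewrite divr_gt0.
  have i1i : i1 != i by rewrite -val_eqE/= neq_ltn i_ge1.
  move=> ae; apply: (not_ae_dominated n_gt1 hP s0 i1i kappa0 (mu := mu)).
  apply: filterS2 ae (T_gt0_ae n_gt1 hP mu i s0) => x.
  rewrite improved_laterE /equivariant => + T0; rewrite T0 => /esym/max_idPl h.
  rewrite /kappa mulrAC ler_pdivrMr// [leRHS]mulrC; apply: le_trans h.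
  rewrite ler_pM2l// (bigD1 i1)//= addrCA lerDl addr_ge0 ?T_ge0//.
  by apply: sumr_ge0 => j _; exact: T_ge0.
Qed.

Lemma improved_later_dominates (i : 'I_k) : (1 <= i)%N ->
  dominates X P p i (improved_later p i) (equivariant (d0 n p i) i).
Proof.
move=> i_ge1; split.
- by apply: is_estimatorP; exact: measurable_improved_later.
- by move=> mu s s0 so; exact/ltW/improved_later_lt_risk.
- exists (fun=> 1); split=> [j|j l _ //|mu]; first exact: ltr01.
  by apply: improved_later_lt_risk => // j; exact: ltr01.
Qed.

End improved_estimators.

Theorem corollary3p3 (R : realType) (k : nat) (hk : (2 <= k)%N)
  (n : 'I_k -> nat) (hn : forall i : 'I_k, (2 <= n i)%N)
  (p : R) (hp : p != 0)
  (d : measure_display) (Omega : measurableType d)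
  (X : forall i : 'I_k, 'I_(n i) -> {mfun Omega >-> R})
  (P : ('I_k -> R) -> ('I_k -> R) -> probability Omega R)
  (hP : exponential_model X P) :
  [/\ forall c : R,
        best_affine_equivariant X P p (pop1 hk) c <-> c = d0 n p (pop1 hk),
      inadmissible X P p (pop1 hk)
        (equivariant (d0 n p (pop1 hk)) (pop1 hk)) &
      dominates X P p (pop1 hk) (improved_first p hk)
        (equivariant (d0 n p (pop1 hk)) (pop1 hk))] /\
  forall i : 'I_k, (1 <= i)%N ->
    [/\ forall c : R, best_affine_equivariant X P p i c <-> c = d0 n p i,
        inadmissible X P p i (equivariant (d0 n p i) i) &
        dominates X P p i (improved_later p i)
          (equivariant (d0 n p i) i)].
Proof.
have n_gt1 i : (1 < n i)%N by exact: hn.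
have dom1 := improved_first_dominates hk n_gt1 hp hP.
have domi i := @improved_later_dominates _ _ hk _ n_gt1 _ hp _ _ _ _ hP i.
split=> [|i i_ge1]; split.
- by move=> c; exact: best_affine_equivariantP.
- by exists (improved_first p hk).
- exact: dom1.
- by move=> c; exact: best_affine_equivariantP.
- by exists (improved_later p i); exact: domi.
- exact: domi.
Qed.
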